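(* Let $\Gamma$ be a Coxeter diagram of rank $n=|V(\Gamma)|\ge 1$ and let $W_\Gamma$ be the associated Coxeter group. Let $\Omega^k$, $1\le k\le n$, be its $\mathcal O$-graphs, and let $W_{\Delta_1},\ldots,W_{\Delta_m}$ be the maximal (with respect to inclusion) spherical standard parabolic subgroups of $W_\Gamma$. Then $$|\pi_0(\Omega^1)|+\cdots+|\pi_0(\Omega^n)|\ \le\ \mathrm{cc}_2(W_\Gamma)\ \le\ \mathrm{cc}_2(W_{\Delta_1})+\cdots+\mathrm{cc}_2(W_{\Delta_m})$$ and $$1\le \mathrm{cc}_2(W_\Gamma)\le\begin{cases}2^n-1&\text{if }W_\Gamma\text{ is finite},\\ 2^n-2&\text{otherwise.}\end{cases}$$ The numerical bounds in the second chain of inequalities (the lower bound $1$, the upper bound $2^n-1$ for finite groups, and the upper bound $2^n-2$ for infinite groups) are sharp, i.e. attained, and they are attained also by nonabelian Coxeter groups. Moreover, if an infinite Coxeter group $W_\Gamma$ of rank $n\ge3$ attains the upper bound, i.e. $\mathrm{cc}_2(W_\Gamma)=2^n-2$, then $n=3$ and $W_\Gamma$ is isomorphic to a triangle group of the form $\Delta(2p,2q,2r)$ with $p,q,r$ positive integers.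
   Context: A Coxeter system $(W,S)$ of finite rank has $S=\{s_i\mid i\in I\}$, $I$ finite, and $W=\langle S\mid (s_is_j)^{m_{i,j}}\ (i,j\in I,\ m_{i,j}<\infty)\rangle$, with $m_{i,i}=1$ and $m_{i,j}=m_{j,i}\in\{2,3,\dots\}\cup\{\infty\}$ for $i\neq j$. Its Coxeter diagram $\Gamma$ has vertex set $V(\Gamma)=S$ and an edge $\{s_i,s_j\}$ iff $m_{i,j}\ge 3$, labeled by $m_{i,j}$ when $m_{i,j}\geq 4$ and unlabeled when $m_{i,j}=3$; one writes $W=W_\Gamma$. For $J\subseteq I$, $S_J=\{s_j\mid j\in J\}$, $W_J=\langle S_J\rangle$ is a standard parabolic subgroup of rank $|J|$, and $\Gamma_J$ is the full subgraph of $\Gamma$ on $S_J$. Spherical means finite. An involution is an element of order exactly $2$; $\mathrm{cc}_2(G)$ is the number of conjugacy classes of involutions in $G$. $\pi_0$ denotes the set of connected components. $\mathcal O$-graphs: $\Omega^1$ is the graph with vertex set $S$ (identified with the rank-one standard parabolic subgroups) and an edge $\{s_i,s_j\}$ iff $m_{i,j}$ is finite, odd and $\ge3$. For $k\ge2$, the vertices of $\Omega^k$ are the rank-$k$ standard parabolic subgroups $W_J$ such that every connected component of $\Gamma_J$ is a Coxeter diagram of one of the types $\mathtt A_1$, $\mathtt B_n$ ($n\ge2$), $\mathtt D_{2n}$ ($n\ge2$), $\mathtt E_7$, $\mathtt E_8$, $\mathtt F_4$, $\mathtt G_2$, $\mathtt H_3$, $\mathtt H_4$, $\mathtt I_2(2m)$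 ($m\ge2$), and two distinct vertices $W_J,W_K$ of $\Omega^k$ are joined by an edge iff $W_J$ and $W_K$ are isomorphic groups. Triangle group: $\Delta(a,b,c)=\langle s_1,s_2,s_3\mid s_1^2,s_2^2,s_3^2,(s_1s_2)^a,(s_1s_3)^b,(s_2s_3)^c\rangle$ for integers $a,b,c\ge2$. *)

(* Defs.v *)
From HB Require Import structures.
From Stdlib Require Import Relation_Operators.
From mathcomp Require Import all_boot finmap.
From mathcomp Require Import boolp classical_sets functions cardinality.

Set Implicit Arguments.
Unset Strict Implicit.
Unset Printing Implicit Defensive.

Local Open Scope classical_set_scope.
Local Open Scope quotient_scope.

(* Only used on finite sets; the value on an infinite set is 0. *)
Definition card_set (T : choiceType) (A : set T) : nat := #|` fset_set A|%fset.

(* The letter (x, false) stands for x and (x, true) for its inverse. *)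
Definition word (X : choiceType) := seq (X * bool).

Section Presentation.
Variables (X : choiceType) (R : set (word X)).

Definition letter_inv (l : X * bool) : X * bool := (l.1, ~~ l.2).

Definition word_inv (w : word X) : word X := rev (map letter_inv w).

Inductive pres_eq : word X -> word X -> Prop :=
| Pres_refl u : pres_eq u u
| Pres_sym u v : pres_eq u v -> pres_eq v u
| Pres_trans u v w : pres_eq u v -> pres_eq v w -> pres_eq u w
| Pres_cat u u' v v' :
    pres_eq u u' -> pres_eq v v' -> pres_eq (u ++ v) (u' ++ v')
| Pres_cancel l : pres_eq [:: l; letter_inv l] [::]
| Pres_relator w : R w -> pres_eq w [::].

Definition pres_rel (u v : word X) : bool := `[< pres_eq u v >].

Lemma pres_rel_refl : reflexive pres_rel.
Proof. by move=> u; apply/asboolP; exact: Pres_refl. Qed.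

Lemma pres_rel_sym : symmetric pres_rel.
Proof. by move=> u v; apply/asboolP/asboolP; exact: Pres_sym. Qed.

Lemma pres_rel_trans : transitive pres_rel.
Proof.
by move=> v u w /asboolP uv /asboolP vw; apply/asboolP; exact: Pres_trans vw.
Qed.

Canonical pres_equiv := EquivRel pres_rel pres_rel_refl pres_rel_sym
  pres_rel_trans.

Definition presented_group := {eq_quot pres_equiv}.

HB.instance Definition _ := Choice.on presented_group.

Implicit Types x y z : presented_group.

Definition pres_class (w : word X) : presented_group := \pi_presented_group w.

Lemma pres_classP u v : pres_class u = pres_class v <-> pres_eq u v.
Proof.
split=> [|uv]; first by move/eqmodP/asboolP.
by apply/eqmodP/asboolP.
Qed.

Lemma pres_reprK x : pres_class (repr x) = x.
Proof. exact: reprK. Qed.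

Lemma pres_repr_class u : pres_eq (repr (pres_class u)) u.
Proof. by apply/pres_classP; rewrite pres_reprK. Qed.

Lemma pres_eq_cancel u l v : pres_eq (u ++ l :: letter_inv l :: v) (u ++ v).
Proof.
apply: Pres_cat; first exact: Pres_refl.
exact: Pres_cat (Pres_cancel l) (Pres_refl v).
Qed.

Lemma word_inv_cons l w : word_inv (l :: w) = word_inv w ++ [:: letter_inv l].
Proof. by rewrite /word_inv /= rev_cons cats1. Qed.

Lemma pres_eq_invl w : pres_eq (word_inv w ++ w) [::].
Proof.
elim: w => [|[x b] w IHw]; first exact: Pres_refl.
rewrite word_inv_cons -catA; apply: Pres_trans IHw.
by have := pres_eq_cancel (word_inv w) (x, ~~ b) w; rewrite /letter_inv /= negbK.
Qed.

Lemma pres_eq_invr w : pres_eq (w ++ word_inv w) [::].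
Proof.
elim: w => [|l w IHw]; first exact: Pres_refl.
rewrite word_inv_cons catA cat_cons; apply: Pres_trans (Pres_cancel l).
apply: (@Pres_cat [:: l] [:: l]); first exact: Pres_refl.
exact: Pres_cat IHw (Pres_refl [:: letter_inv l]).
Qed.

Lemma pres_eq_inv u v : pres_eq u v -> pres_eq (word_inv u) (word_inv v).
Proof.
move=> uv; apply: (@Pres_trans _ (word_inv u ++ v ++ word_inv v)).
  rewrite -[X in pres_eq X _]cats0; apply: Pres_cat; first exact: Pres_refl.
  exact/Pres_sym/pres_eq_invr.
rewrite catA; apply: (@Pres_cat _ [::]) (Pres_refl _).
apply: Pres_trans (pres_eq_invl u).
exact: Pres_cat (Pres_refl _) (Pres_sym uv).
Qed.

Definition pres_one : presented_group := pres_class [::].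
Definition pres_mul x y : presented_group := pres_class (repr x ++ repr y).
Definition pres_inv x : presented_group := pres_class (word_inv (repr x)).

Lemma pres_mulE u v : pres_mul (pres_class u) (pres_class v) = pres_class (u ++ v).
Proof. by apply/pres_classP/Pres_cat; exact: pres_repr_class. Qed.

Lemma pres_invE u : pres_inv (pres_class u) = pres_class (word_inv u).
Proof. by apply/pres_classP/pres_eq_inv; exact: pres_repr_class. Qed.

Lemma pres_mulA : associative pres_mul.
Proof.
move=> x y z; rewrite -(pres_reprK x) -(pres_reprK y) -(pres_reprK z).
by rewrite !pres_mulE catA.
Qed.

Lemma pres_mul1g : left_id pres_one pres_mul.
Proof. by move=> x; rewrite -(pres_reprK x) pres_mulE. Qed.

Lemma pres_mulg1 : right_id pres_one pres_mul.
Proof. by move=> x; rewrite -(pres_reprK x) pres_mulE cats0. Qed.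

Lemma pres_mulgV : right_inverse pres_one pres_inv pres_mul.
Proof.
move=> x; rewrite -(pres_reprK x) pres_invE pres_mulE.
exact/pres_classP/pres_eq_invr.
Qed.

Lemma pres_mulVg : left_inverse pres_one pres_inv pres_mul.
Proof.
move=> x; rewrite -(pres_reprK x) pres_invE pres_mulE.
exact/pres_classP/pres_eq_invl.
Qed.

HB.instance Definition _ := isGroup.Build presented_group
  pres_mulA pres_mul1g pres_mulg1 pres_mulVg pres_mulgV.

Definition pres_gen (x : X) : presented_group := pres_class [:: (x, false)].

End Presentation.

Definition word_pow (X : choiceType) (w : word X) (n : nat) : word X :=
  flatten (nseq n w).

Section Subgroups.
Local Open Scope group_scope.
Variable G : groupType.
Implicit Types (A H : set G) (x y : G).

Definition is_subgroup H :=
  [/\ H 1, (forall x y, H x -> H y -> H (x * y)) & (forall x, H x -> H x^-1)].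

Definition generated A : set G := smallest is_subgroup A.

Definition involution x := x <> 1 /\ x ^+ 2 = 1.

Definition involution_classes H : set (set G) :=
  [set [set x ^ g | g in H] | x in [set x | H x /\ involution x]].

Definition cc2 H : nat := card_set (involution_classes H).

Definition nonabelian := exists x y : G, x * y <> y * x.

End Subgroups.

Definition isomorphic (G1 G2 : groupType) (H1 : set G1) (H2 : set G2) :=
  exists f : G1 -> G2, set_bij H1 H2 f /\
    (forall x y, H1 x -> H1 y -> f (x * y) = f x * f y)%g.

Record graph (T : Type) := Graph {
  vertices : set T;
  adjacent : T -> T -> Prop }.

Definition edge (T : Type) (E : graph T) (x y : T) :=
  [/\ vertices E x, vertices E y & adjacent E x y].

Definition pi0 (T : Type) (E : graph T) : set (set T) :=
  [set [set y | clos_refl_trans T (edge E) x y] | x in vertices E].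

(* The value 0 encodes the label infinity. *)
Record coxeter_matrix (I : finType) := CoxeterMatrix {
  cox_entry :> I -> I -> nat;
  cox_diag : forall i, cox_entry i i = 1;
  cox_sym : forall i j, cox_entry i j = cox_entry j i;
  cox_off_diag : forall i j, i != j -> cox_entry i j <> 1 }.

Section Coxeter.
Variables (I : finType) (M : coxeter_matrix I).

Definition coxeter_relators : set (word I) :=
  [set w | exists i j, M i j <> 0 /\
           w = word_pow [:: (i, false); (j, false)] (M i j)].

Definition coxeter_group : groupType := presented_group coxeter_relators.

Definition simple_refl (i : I) : coxeter_group := pres_gen coxeter_relators i.

Definition parabolic (J : {set I}) : set coxeter_group :=
  generated [set simple_refl j | j in [set` J]].

Definition maximal_spherical : set (set coxeter_group) :=
  [set H | [/\ exists J, H = parabolic J,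
               finite_set H
             & forall K, finite_set (parabolic K) ->
                 H `<=` parabolic K -> parabolic K = H]].

(* For i <> j the entry is not 1, so "not 2" means finite >= 3 or infinite. *)
Definition diagram (J : {set I}) : graph I :=
  Graph [set` J] (fun i j => i <> j /\ M i j <> 2).

End Coxeter.

Arguments parabolic {I} M J.
Arguments maximal_spherical {I} M.

Inductive diagram_type :=
  TypeA of nat | TypeB of nat | TypeD of nat | TypeE of nat | TypeF4 | TypeG2
| TypeH of nat | TypeI2 of nat.

Definition type_rank (t : diagram_type) : nat :=
  match t with
  | TypeA n | TypeB n | TypeD n | TypeE n | TypeH n => n
  | TypeF4 => 4
  | TypeG2 | TypeI2 _ => 2
  end.

(* A path on the nodes 0, ..., size l, whose successive labels are l. *)
Definition path_label (l : seq nat) (a b : nat) : nat :=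
  if b == a.+1 then nth 2 l a else 2.

(* A path on the nodes 0, ..., n - 2, and the node n - 1 attached to p. *)
Definition branch_label (n p a b : nat) : nat :=
  if (b == a.+1) && (b < n.-1) || (a == p) && (b == n.-1) then 3 else 2.

(* The label between the nodes a < b. *)
Definition type_label_lt (t : diagram_type) : nat -> nat -> nat :=
  match t with
  | TypeA n => path_label (nseq n.-1 3)
  | TypeB n => path_label (rcons (nseq (n - 2) 3) 4)
  | TypeD n => branch_label n (n - 3)
  | TypeE n => branch_label n 2
  | TypeF4 => path_label [:: 3; 4; 3]
  | TypeG2 => path_label [:: 6]
  | TypeH n => path_label (5 :: nseq (n - 2) 3)
  | TypeI2 m => path_label [:: m]
  end.

Definition type_label (t : diagram_type) (a b : nat) : nat :=
  if a == b then 1 else type_label_lt t (minn a b) (maxn a b).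

Definition has_type (I : finType) (M : coxeter_matrix I) (C : set I)
    (t : diagram_type) :=
  exists f : 'I_(type_rank t) -> I, set_bij setT C f /\
    forall a b, M (f a) (f b) = type_label t a b.

Definition O_type (t : diagram_type) : Prop :=
  match t with
  | TypeA n => n = 1
  | TypeB n => 2 <= n
  | TypeD n => exists2 k, 2 <= k & n = k.*2
  | TypeE n => n = 7 \/ n = 8
  | TypeF4 | TypeG2 => True
  | TypeH n => n = 3 \/ n = 4
  | TypeI2 l => exists2 m, 2 <= m & l = m.*2
  end.

Section OGraphs.
Variables (I : finType) (M : coxeter_matrix I).

Definition Omega1 : graph (coxeter_group M) :=
  Graph [set simple_refl M i | i in setT]
    (fun x y => exists i j, [/\ x = simple_refl M i, y = simple_refl M j,
                                odd (M i j) & 3 <= M i j]).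

Definition Omega (k : nat) : graph (set (coxeter_group M)) :=
  Graph [set H | exists J : {set I}, [/\ #|J| = k, H = parabolic M J &
                   forall C, pi0 (diagram M J) C ->
                     exists t, O_type t /\ has_type M C t]]
    (fun H K => H <> K /\ isomorphic H K).

Definition O_components (k : nat) : nat :=
  if k == 1 then card_set (pi0 Omega1) else card_set (pi0 (Omega k)).

End OGraphs.

Definition triangle_group (a b c : nat) : groupType :=
  let s1 := (inord 0 : 'I_3, false) in
  let s2 := (inord 1 : 'I_3, false) in
  let s3 := (inord 2 : 'I_3, false) in
  presented_group [set` [:: word_pow [:: s1] 2; word_pow [:: s2] 2;
    word_pow [:: s3] 2; word_pow [:: s1; s2] a; word_pow [:: s1; s3] b;
    word_pow [:: s2; s3] c]].

(* Main.v *)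
(* By a theorem of Richardson every involution of a Coxeter group is conjugate to the
   longest element [w_J] of a finite standard parabolic [W_J] in which [w_J] is
   central. This gives both upper bounds: [J] is nonempty, it is not the whole index
   set when the group is infinite, and [W_J] lies in a maximal spherical parabolic.
   Conversely, if [w_J] and [w_K] are conjugate, a conjugating element of minimal
   length carries the simple reflections of [W_J] onto those of [W_K]; so [J] and [K]
   have the same size and the parabolics are isomorphic, and distinct components of
   the O-graphs give distinct classes once [w_J] is known to be central for the listed
   types. There it acts as -1 in the geometric representation: on sign coordinates for
   B and D, as a power of a Coxeter element for the exceptional types.
   If an infinite group of rank at least 3 attains the bound, all proper subsets [J]
   are spherical with [w_J] central and pairwise nonconjugate, so all labels are finite
   and even. In rank at least 4 no rank three subsystem contains two labels above 2,
   since it would be infinite; then the diagram is a matching and the group is finite,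
   a contradiction. *)

From Stdlib Require Import Relation_Operators Operators_Properties Reals Lra Lia.
Require Import Defs.
From mathcomp Require Import all_boot finmap.
From mathcomp Require Import boolp classical_sets functions cardinality.
From mathcomp Require Import zify.

Set Implicit Arguments.
Unset Strict Implicit.
Unset Printing Implicit Defensive.

Local Open Scope group_scope.
Local Open Scope classical_set_scope.

Delimit Scope R_scope with Re.

(** The group is a bare presentation, so whatever says that it does not collapse (nontrivial
    elements, exact orders, nonconjugacy) needs an action on which the relators are checked. Three
    are used: on reflections with signs, whose cocycle gives the exchange condition; on real linear
    forms; and on two points, giving the homomorphisms to Z/2 that separate simple reflections.
    Linear forms are used instead of vectors, so neither an inner product nor a root system is
    constructed: a root is known by its values on forms. Finiteness of the listed types is not
    presupposed. A word acting as -1 has, by positivity, all of [J] as descents; centrality comes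
    from faithfulness, uniqueness and finiteness from length arguments. Counting takes place among
    subsets of [I]: each class of involutions selects one [J], injectively because [J] determines
    its longest element. As the size of [J] is a class invariant, O-graphs of different index select
    different subsets. Index 1 needs its own argument, since there edges come from odd labels and
    not from isomorphism. *)

(** * Actions and homomorphisms of presented groups *)

Lemma act_word_pres_eq (X : choiceType) (R : set (word X)) (Z : Type)
    (act : X * bool -> Z -> Z) :
    (forall l z, act l (act (letter_inv l) z) = z) ->
    (forall w, R w -> forall z, foldr act z w = z) ->
  forall u v, pres_eq R u v -> forall z, foldr act z u = foldr act z v.
Proof.
move=> actK actR u v; elim=> //= {u v}.
- by move=> u v w _ IH1 _ IH2 z; rewrite IH1.
- by move=> u u' v v' _ IH1 _ IH2 z; rewrite !foldr_cat IH2.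
Qed.

Section Lift.
Variables (X : choiceType) (R : set (word X)) (H : groupType) (phi : X -> H).

Definition letter_val (l : X * bool) : H :=
  if l.2 then (phi l.1)^-1 else phi l.1.

Definition word_val (w : word X) : H := foldr (fun l h => letter_val l * h) 1 w.

Lemma word_val_cat u v : word_val (u ++ v) = word_val u * word_val v.
Proof. by elim: u => [|l u IH] /=; rewrite ?mul1g // IH mulgA. Qed.

Lemma word_val_pow w n : word_val (word_pow w n) = word_val w ^+ n.
Proof. by elim: n => [|n IH] //; rewrite expgS -IH -word_val_cat. Qed.

Hypothesis valR : forall w, R w -> word_val w = 1.

Definition pres_lift (x : presented_group R) : H := word_val (repr x).

Lemma pres_lift_class w : pres_lift (pres_class R w) = word_val w.
Proof.
have foldE u z :
    foldr (fun l => *%g (letter_val l)) z u = word_val u * z.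
  by elim: u => [|l u IH] /=; rewrite ?mul1g // IH mulgA.
suff /(_ 1) : forall z, foldr (fun l => *%g (letter_val l)) z
    (repr (pres_class R w)) = foldr (fun l => *%g (letter_val l)) z w.
  by rewrite !foldE !mulg1.
apply: (@act_word_pres_eq _ R) (pres_repr_class R w).
  by move=> [x []] z; rewrite /letter_val /= ?mulKg ?mulVKg.
by move=> u Ru z; rewrite foldE valR // mul1g.
Qed.

Lemma pres_liftM x y : pres_lift (x * y) = pres_lift x * pres_lift y.
Proof.
rewrite -(pres_reprK x) -(pres_reprK y).
by have := pres_mulE R (repr x) (repr y); rewrite /mul /= => ->;
  rewrite !pres_lift_class word_val_cat.
Qed.

Lemma pres_lift_gen i : pres_lift (pres_gen R i) = phi i.
Proof. by rewrite pres_lift_class /word_val /= mulg1. Qed.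

End Lift.

(** * The exchange condition *)

Section CoxeterGroup.
Variables (I : finType) (M : coxeter_matrix I).

Local Notation W := (coxeter_group M).
Local Notation s := (simple_refl M).
Implicit Types (i j : I) (x y : W) (w : seq I) (J : {set I}).

Lemma mul_pres_class (u v : word I) :
  (pres_class (coxeter_relators M) u : W) * pres_class _ v = pres_class _ (u ++ v).
Proof. exact: pres_mulE. Qed.

Lemma simple_rel i j : M i j <> 0 -> (s i * s j) ^+ M i j = 1 :> W.
Proof.
move=> Mij.
have -> : s i * s j = pres_class (coxeter_relators M) [:: (i, false); (j, false)].
  exact: mul_pres_class.
have powE n (w : word I) : (pres_class (coxeter_relators M) w : W) ^+ n =
    pres_class _ (word_pow w n).
  by elim: n => [|n IH] //; rewrite expgS IH mul_pres_class.
rewrite powE; apply/pres_classP/Pres_relator.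
by exists i, j.
Qed.

Lemma simpleK i : s i * s i = 1.
Proof. by have := @simple_rel i i; rewrite cox_diag expg1; apply. Qed.

Lemma simpleV i : (s i)^-1 = s i.
Proof. by apply: mulg1_eq; exact: simpleK. Qed.

Lemma mulKs i x : s i * (s i * x) = x.
Proof. by rewrite mulgA simpleK mul1g. Qed.

Lemma mulsK i x : x * s i * s i = x.
Proof. by rewrite -mulgA simpleK mulg1. Qed.

Definition prods w : W := foldr (fun i x => s i * x) 1 w.

Lemma prods_cat w w' : prods (w ++ w') = prods w * prods w'.
Proof. by elim: w => [|i w IH] /=; rewrite ?mul1g // IH mulgA. Qed.

Lemma prods_rcons w i : prods (rcons w i) = prods w * s i.
Proof. by rewrite -cats1 prods_cat /= mulg1. Qed.

Lemma prods_rev w : prods (rev w) = (prods w)^-1.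
Proof.
by elim: w => [|i w IH] /=; rewrite ?invg1 // rev_cons prods_rcons IH invgM simpleV.
Qed.

Lemma prods_surj x : exists w, x = prods w.
Proof.
rewrite -(pres_reprK x); elim: (repr x : word I) => [|l u [w IH]].
  by exists [::].
exists (l.1 :: w); rewrite /= -IH -cat1s -mul_pres_class.
congr (_ * _); case: l => i [] //=; rewrite -simpleV.
exact/esym/pres_invE.
Qed.

Section Action.
Variables (Z : Type) (act : I -> Z -> Z).
Hypothesis act_rel : forall i j, M i j <> 0 ->
  forall z : Z, iter (M i j) (fun z => act i (act j z)) z = z.
Implicit Type z : Z.

(** The exponent bit of a letter is dropped: by the relation with [M i i = 1] each generator acts as
    an involution. *)
Definition cact x z : Z := foldr (fun l => act l.1) z (repr x : word I).

Lemma cact_class (u : word I) z :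
  cact (pres_class _ u) z = foldr (fun l => act l.1) z u.
Proof.
rewrite /cact; apply: (@act_word_pres_eq _ (coxeter_relators M)).
- by move=> [i b] t; have := @act_rel i i; rewrite cox_diag; apply.
- move=> _ [i [j [Mij ->]]] t; rewrite -[RHS](act_rel Mij).
  by elim: (M i j) => //= n ->.
- exact: pres_repr_class.
Qed.

Lemma cactM x y z : cact (x * y) z = cact x (cact y z).
Proof.
rewrite -(pres_reprK x) -(pres_reprK y) mul_pres_class !cact_class.
by rewrite foldr_cat.
Qed.

Lemma cact1 z : cact 1 z = z.
Proof. exact: (cact_class [::]). Qed.

Lemma cact_simple i z : cact (s i) z = act i z.
Proof. exact: (cact_class [:: (i, false)]). Qed.

End Action.

(* Conjugation of reflections, with a sign recording each crossing of the hyperplane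
   of [s i]; its cocycle [inv] yields the exchange condition. *)
Definition refl_act i (p : W * bool) : W * bool :=
  (s i * p.1 * s i, p.2 (+) (p.1 == s i)).

(** The bit flips once for each of the [2 n] reflections met along the word. For [n = M i j] this
    list runs twice through the same period, so all flips cancel; that is the Coxeter relation in
    [refl_act_rel]. *)
Lemma refl_act_iter i j n t b :
  iter n (fun p => refl_act i (refl_act j p)) (t, b) =
  ((s i * s j) ^+ n * t * (s j * s i) ^+ n,
   b (+) odd (count (fun k => t == (s j * s i) ^+ k * s j) (iota 0 n.*2))).
Proof.
elim: n => [|n IH]; first by rewrite /= mul1g mulg1 addbF.
rewrite iterS IH /refl_act.
have -> : (n.+1.*2 = n.*2 + 2)%N by rewrite doubleS addn2.
rewrite iotaD count_cat oddD add0n [iota n.*2 2]/= [count _ [:: _; _]]/= addn0 oddD.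
rewrite !oddb [fst _]/= [snd _]/=.
set a := s i * s j; set c := s j * s i.
have aE k : a ^+ k = c ^- k by rewrite -expVgn /c invgM !simpleV.
have sa k : s j * a ^+ k = c ^+ k * s j.
  elim: k => [|k IHk]; first by rewrite mulg1 mul1g.
  by rewrite expgSr mulgA IHk expgSr /a /c !mulgA.
have sc k : c ^+ k * s j = s j * a ^+ k by rewrite sa.
congr (_, _); first by rewrite (expgS a) (expgSr c) {1}/a {3}/c !mulgA.
rewrite -!addbA; congr (_ (+) (_ (+) _)).
(* Conjugation by the [n]-th power shifts exponents by [2 n], so one more round tests exactly the
   exponents [2 n] and [2 n + 1]. *)
have E m : (a ^+ n * t * c ^+ n == c ^+ m * s j) =
           (t == c ^+ (n.*2 + m) * s j).
  have -> : c ^+ (n.*2 + m) * s j = c ^+ n * (c ^+ m * s j) * a ^+ n.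
    by rewrite -!mulgA sa !mulgA -!expgnDr addnAC addnn.
  apply/eqP/eqP => [<-|->].
    by rewrite aE -!mulgA mulVKg mulgV mulg1.
  by rewrite aE -!mulgA mulKg mulVg mulg1.
have := E 0; rewrite mul1g addn0 => ->.
have -> : (s j * (a ^+ n * t * c ^+ n) * s j == s i) =
          (a ^+ n * t * c ^+ n == c ^+ 1 * s j).
  have -> : c ^+ 1 * s j = s j * s i * s j by [].
  apply/eqP/eqP => [<-|->]; last by rewrite !mulgA simpleK mul1g mulsK.
  by rewrite !mulgA simpleK mul1g mulsK.
by rewrite E addn1; case: (t == _); case: (t == _).
Qed.

Lemma refl_act_rel i j : M i j <> 0 -> forall p : W * bool,
  iter (M i j) (fun p => refl_act i (refl_act j p)) p = p.
Proof.
move=> Mij [t b]; rewrite refl_act_iter.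
have c1 : (s j * s i) ^+ M i j = 1 by rewrite cox_sym simple_rel // cox_sym.
rewrite simple_rel // c1 mul1g mulg1; congr (_, _).
rewrite -addnn iotaD count_cat oddD add0n.
have -> : iota (M i j) (M i j) = map (addn (M i j)) (iota 0 (M i j)).
  by rewrite -iotaDl addn0.
rewrite count_map (@eq_count _ _ (fun k => t == (s j * s i) ^+ k * s j)).
  by rewrite addbb addbF.
by move=> k /=; rewrite expgnDr c1 mul1g.
Qed.

(* [inv x t] says whether the reflection [t] shortens [x] on the right. *)
Definition inv x t : bool := (cact refl_act x (t, false)).2.

Lemma cact_refl x t b : cact refl_act x (t, b) = (x * t * x^-1, b (+) inv x t).
Proof.
rewrite /inv; have [w ->] := prods_surj x; elim: w t b => [|i w IH] t b /=.
  by rewrite !(cact1 refl_act_rel) mul1g invg1 mulg1 addbF.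
rewrite !(cactM refl_act_rel) !(cact_simple refl_act_rel) IH /refl_act /=.
by rewrite [in RHS]IH /= invgM simpleV !mulgA addbA.
Qed.

Lemma inv1 t : inv 1 t = false.
Proof. by rewrite /inv (cact1 refl_act_rel). Qed.

Lemma invM x y t : inv (x * y) t = inv y t (+) inv x (y * t * y^-1).
Proof. by rewrite {1}/inv (cactM refl_act_rel) !cact_refl. Qed.

Lemma inv_simple i t : inv (s i) t = (t == s i).
Proof. by rewrite /inv (cact_simple refl_act_rel). Qed.

(** The cocycle rule for [y * y^-1 = 1] shows that [y] and [y^-1] contribute equally; they cancel,
    and only the crossing by [s i] remains. *)
Lemma inv_conj y i : inv (y * s i * y^-1) (y * s i * y^-1).
Proof.
set t := y * s i * y^-1.
have yt : y^-1 * t * y^-1^-1 = s i by rewrite invgK !mulgA mulVg mul1g mulgVK.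
have := inv1 t; rewrite -{1}(mulgV y) invM yt => E.
rewrite {1}/t invM yt invM inv_simple eqxx mulgK.
by case: (inv y _) E; case: (inv _ _).
Qed.

Lemma inv_mul_refl x y i :
  inv (x * (y * s i * y^-1)) (y * s i * y^-1) = ~~ inv x (y * s i * y^-1).
Proof. by rewrite invM inv_conj mulgK. Qed.

Lemma inv_mul_simple x i : inv (x * s i) (s i) = ~~ inv x (s i).
Proof. by have := inv_mul_refl x 1 i; rewrite mul1g invg1 mulg1. Qed.

(** By the cocycle rule [inv (prods w) t] is the parity of the number of letters of [w] whose
    reflection, conjugated by the letters to its right, is [t]. Odd parity provides such a letter,
    and multiplication by [t] deletes it. *)
Lemma strong_exchange w t : inv (prods w) t ->
  exists w1 i w2, [/\ w = w1 ++ i :: w2, t = (prods w2)^-1 * s i * prods w2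
                    & prods w * t = prods (w1 ++ w2)].
Proof.
elim: w => [|i w IH] /=; first by rewrite inv1.
rewrite invM inv_simple; case Ew: (inv _ t) => /=.
  by have [w1 [j [w2 [-> -> E]]]] := IH Ew => _; exists (i :: w1), j, w2;
    split; rewrite //= -E -!mulgA.
move=> /eqP E; exists [::], i, w; split=> //=.
  by rewrite -E -!mulgA mulKg mulVg mulg1.
by rewrite -mulgA -[prods w * t](mulgVK (prods w)) E mulKs.
Qed.
End CoxeterGroup.

(** * Parabolic subgroups and longest elements *)

Section Length.
Variables (I : finType) (M : coxeter_matrix I).

Local Notation W := (coxeter_group M).
Local Notation s := (simple_refl M).
Local Notation prods := (prods M).
Implicit Types (i j : I) (x y t u v l : W) (w : seq I) (J K : {set I}).

Lemma ex_len x : exists n, `[< exists w, x = prods w /\ size w = n >].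
Proof. by have [w ->] := prods_surj x; exists (size w); apply/asboolP; exists w. Qed.

Definition len x : nat := ex_minn (ex_len x).

Lemma len_word x : exists w, x = prods w /\ size w = len x.
Proof. by rewrite /len; case: ex_minnP => n /asboolP. Qed.

Lemma len_prods w : len (prods w) <= size w.
Proof. by rewrite /len; case: ex_minnP => n _; apply; apply/asboolP; exists w. Qed.

Lemma len1 : len 1 = 0%N.
Proof. by apply/eqP; rewrite -leqn0 (len_prods [::]). Qed.

Lemma len_eq0 x : len x = 0%N -> x = 1.
Proof. by have [[|i w] [-> <-]] := len_word x. Qed.

Lemma lenV x : len x^-1 = len x.
Proof.
suff H y : len y^-1 <= len y by apply/eqP; rewrite eqn_leq H -{1}(invgK x) H.
by have [w [-> <-]] := len_word y; rewrite -prods_rev -size_rev len_prods.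
Qed.

Lemma lenM x y : len (x * y) <= len x + len y.
Proof.
have [[w [-> <-]] [w' [-> <-]]] := (len_word x, len_word y).
by rewrite -prods_cat -size_cat len_prods.
Qed.

Lemma len_simple_le i : (len (s i) <= 1)%N.
Proof. by have := len_prods [:: i]; rewrite /= mulg1. Qed.

Lemma inv_len x t : inv x t -> len (x * t) < len x.
Proof.
have [w [-> <-]] := len_word x => /strong_exchange [w1 [i [w2 [-> _ ->]]]].
by apply: leq_ltn_trans (len_prods _) _; rewrite !size_cat /= addnS.
Qed.

Lemma len_desc x i : inv x (s i) -> len x = (len (x * s i)).+1.
Proof.
move/inv_len => lt_x; apply/eqP; rewrite eqn_leq lt_x andbT.
rewrite -{1}(mulsK i x); apply: leq_trans (lenM _ _) _.
by rewrite -addn1 leq_add2l len_simple_le.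
Qed.

Lemma len_asc x i : inv x (s i) = false -> len (x * s i) = (len x).+1.
Proof. by move=> xi; rewrite (@len_desc (x * s i) i) ?inv_mul_simple ?xi // mulsK. Qed.

Lemma inv_ltn x i : inv x (s i) = (len (x * s i) < len x).
Proof.
case xi: (inv x (s i)); first by rewrite inv_len.
by rewrite (len_asc xi) ltnNge leqnSn.
Qed.

Lemma len_simple i : len (s i) = 1%N.
Proof. by rewrite -(mul1g (s i)) len_asc ?inv1 // len1. Qed.

Definition reduced w := len (prods w) = size w.

Lemma reduced_rcons w i : reduced (rcons w i) -> reduced w.
Proof.
rewrite /reduced prods_rcons size_rcons => E; apply/eqP.
rewrite eqn_leq len_prods -ltnS -E -addn1 -(len_simple i).
exact: lenM.
Qed.

Lemma reduced_rcons_asc w i :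
  reduced (rcons w i) -> inv (prods w) (s i) = false.
Proof.
move=> r; rewrite inv_ltn -prods_rcons r (reduced_rcons r) size_rcons.
by rewrite ltnNge leqnSn.
Qed.

(** The deletion condition. Stated with subwords it keeps the letters inside [J], so elements of
    [W_J] have reduced words in [J]. *)
Lemma reduced_subseq w :
  exists w', [/\ subseq w' w, reduced w' & prods w' = prods w].
Proof.
elim/last_ind: w => [|w i [w' [sub r E]]]; first by exists [::]; split=> //; exact: len1.
case wi: (inv (prods w) (s i)); last first.
  exists (rcons w' i); split; rewrite ?prods_rcons ?E //.
    by rewrite -!cats1 cat_subseq.
  by rewrite /reduced prods_rcons E len_asc // -E r size_rcons.
move: (wi); rewrite -E => /strong_exchange [w1 [j [w2 [Ew _ E']]]].
exists (w1 ++ w2); split.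
- apply: subseq_trans (subseq_rcons w i); apply: subseq_trans sub.
  by rewrite Ew cat_subseq ?subseq_cons.
- have := len_desc wi; rewrite -E E' r {1}Ew !size_cat /= addnS => [[E2]].
  by rewrite /reduced -E2 size_cat.
- by rewrite -E' prods_rcons E.
Qed.

Lemma parabolicP J x :
  parabolic M J x <-> exists w, all [in J] w /\ x = prods w.
Proof.
split=> [|[w [wJ ->]] H [[H1 HM HV] HJ]]; last first.
  elim: w wJ => //= i w IH /andP [iJ /IH wJ]; apply: HM => //.
  by apply: HJ; exists i.
move/(_ [set x | exists w, all [in J] w /\ x = prods w]); apply; split; first split.
- by exists [::].
- move=> _ _ [w [wJ ->]] [w' [wJ' ->]]; exists (w ++ w').
  by rewrite all_cat wJ prods_cat.
- by move=> _ [w [wJ ->]]; exists (rev w); rewrite all_rev prods_rev.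
- by move=> _ [i iJ <-]; exists [:: i]; rewrite /= andbT mulg1.
Qed.

Local Notation "J .-par" := (parabolic M J) (at level 2).

Lemma par1 J : J.-par 1.
Proof. by apply/parabolicP; exists [::]. Qed.

Lemma parM J x y : J.-par x -> J.-par y -> J.-par (x * y).
Proof.
move=> /parabolicP [w [wJ ->]] /parabolicP [w' [wJ' ->]]; apply/parabolicP.
by exists (w ++ w'); rewrite all_cat wJ prods_cat.
Qed.

Lemma parV J x : J.-par x -> J.-par x^-1.
Proof.
move=> /parabolicP [w [wJ ->]]; apply/parabolicP.
by exists (rev w); rewrite all_rev prods_rev.
Qed.

Lemma par_simple J i : i \in J -> J.-par (s i).
Proof. by move=> iJ; apply/parabolicP; exists [:: i]; rewrite /= iJ mulg1. Qed.

Lemma par_prods J w : all [in J] w -> J.-par (prods w).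
Proof. by move=> wJ; apply/parabolicP; exists w. Qed.

Lemma par_setT x : [set: I]%SET.-par x.
Proof. by have [w ->] := prods_surj x; apply: par_prods; apply/allP => i; rewrite inE. Qed.

Lemma parS J K x : J \subset K -> J.-par x -> K.-par x.
Proof.
move=> sJK /parabolicP [w [/allP wJ ->]]; apply: par_prods.
by apply/allP => i /wJ; exact: (fintype.subsetP sJK).
Qed.

Lemma par_reduced J x :
  J.-par x -> exists w, [/\ all [in J] w, reduced w & x = prods w].
Proof.
move=> /parabolicP [w [wJ ->]]; have [w' [/mem_subseq sub r <-]] := reduced_subseq w.
by exists w'; split=> //; apply/allP => i /sub; exact: (allP wJ).
Qed.

Lemma inv_par J x t : J.-par x -> inv x t -> J.-par t.
Proof.
move=> /parabolicP [w [wJ ->]] /strong_exchange [w1 [i [w2 [E -> _]]]].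
move: wJ; rewrite E all_cat /= => /and3P [_ iJ w2J].
exact: parM (parM (parV (par_prods w2J)) (par_simple iJ)) (par_prods w2J).
Qed.

Lemma par_desc J x : J.-par x -> x <> 1 -> exists2 j, j \in J & inv x (s j).
Proof.
move=> /par_reduced [w [wJ r ->]]; case/lastP: w wJ r => // w j.
rewrite all_rcons => /andP [jJ _] r _; exists j => //.
by rewrite prods_rcons inv_mul_simple reduced_rcons_asc.
Qed.

(** [v] is a minimal length representative of the coset [v W_J]. *)
Definition minr J v := forall u, J.-par u -> len v <= len (v * u).

Lemma minr_decomp J x : exists v u, [/\ x = v * u, J.-par u & minr J v].
Proof.
pose P n := `[< exists2 u, J.-par u & n = len (x * u) >].
have exP : exists n, P n.
  by exists (len x); apply/asboolP; exists 1; rewrite ?mulg1 //; exact: par1.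
have [n /asboolP [u uJ ->] minP] := ex_minnP exP.
exists (x * u), u^-1; split; rewrite ?mulgK //; first exact: parV.
move=> u' u'J; apply: minP; apply/asboolP; exists (u * u'); rewrite ?mulgA //.
exact: parM.
Qed.

Lemma minr_inv J v t : minr J v -> J.-par t -> inv v t = false.
Proof. by move=> min_v tJ; apply/negbTE/negP => /inv_len; rewrite ltnNge min_v. Qed.

Lemma minr_inv_mul J v u j :
  minr J v -> J.-par u -> j \in J -> inv (v * u) (s j) = inv u (s j).
Proof.
move=> min_v uJ jJ; rewrite invM (minr_inv min_v) ?addbF //.
exact: parM (parM uJ (par_simple jJ)) (parV uJ).
Qed.

Lemma minr_len J v u : minr J v -> J.-par u -> len (v * u) = len v + len u.
Proof.
move=> min_v /par_reduced [w [wJ r ->]].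
elim/last_ind: w wJ r => [|w j IH]; first by rewrite mulg1 len1 addn0.
rewrite all_rcons => /andP [jJ wJ] r; have rw := reduced_rcons r.
have wj := reduced_rcons_asc r.
rewrite prods_rcons mulgA !len_asc ?IH ?addnS //.
by rewrite (minr_inv_mul min_v) //; exact: par_prods.
Qed.

(** If [v = v' * u] with [v'] minimal and [u] in [W_J] nontrivial, a descent of [u] in [J] would be
    a descent of [v]. *)
Lemma minrP J v : (forall j, j \in J -> inv v (s j) = false) -> minr J v.
Proof.
move=> asc_v; have [v' [u [E uJ min_v']]] := minr_decomp J v.
have [u1|u1] := pselect (u = 1); first by rewrite E u1 mulg1.
have [j jJ] := par_desc uJ u1.
by rewrite -(minr_inv_mul min_v' uJ jJ) -E asc_v.
Qed.

(** The longest element, characterised by its descents so that [W_J] is not assumed finite; its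
    existence implies finiteness in [long_finite]. *)
Definition long J l := J.-par l /\ forall j, j \in J -> inv l (s j).

(** Every element of [W_J] ends some reduced expression of [l]. Uniqueness, maximality and the
    involution property of [l] are all read off from this formula. *)
Lemma long_len J l x : long J l -> J.-par x -> len (l * x^-1) + len x = len l.
Proof.
move=> [lJ desc_l] /par_reduced [w [wJ r ->]].
elim/last_ind: w wJ r => [|w j IH]; first by rewrite invg1 mulg1 len1 addn0.
rewrite all_rcons => /andP [jJ wJ] r; have rw := reduced_rcons r.
have wj := reduced_rcons_asc r.
rewrite prods_rcons invgM simpleV len_asc // addnS -addSn -(IH wJ rw).
congr (_ + _); set y := l * (prods w)^-1.
have El : l = y * prods w by rewrite mulgVK.
set t := prods w * s j * (prods w)^-1.
(* The descent [s j] of [l = y * prods w] is not contributed by [prods w], so the cocycle rule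
   attributes it to [y]. *)
have yt : inv y t by have := desc_l j jJ; rewrite {1}El invM wj.
have Ey : l * (s j * (prods w)^-1) = y * t.
  by rewrite /y /t !mulgA mulgVK.
rewrite Ey; apply/eqP; rewrite eqn_leq inv_len //= -ltnS.
have : len l <= len (y * t) + (size w).+1.
  rewrite -(size_rcons w j) -r; apply: leq_trans (lenM _ _).
  by rewrite prods_rcons -Ey !mulgA mulgVK mulsK.
by rewrite -(IH wJ rw) rw addnS -addSn leq_add2r ltnS.
Qed.

Lemma long_uniq J l l' : long J l -> long J l' -> l = l'.
Proof.
move=> L L'; have := long_len L L'.1; have := long_len L' L.1.
move=> <- /eqP; rewrite addnA -[X in _ == X]add0n eqn_add2r addn_eq0.
by move=> /andP [/eqP/len_eq0/divg1_eq].
Qed.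

Lemma long_sq J l : long J l -> l * l = 1.
Proof.
move=> L; have := long_len L (parV L.1); rewrite invgK lenV.
by move/eqP; rewrite -[X in _ == X]add0n eqn_add2r => /eqP/len_eq0.
Qed.

Lemma long_le J l x : long J l -> J.-par x -> len x <= len l.
Proof. by move=> L xJ; rewrite -(long_len L xJ) leq_addl. Qed.

Lemma finite_len n : finite_set [set x | len x <= n].
Proof.
apply: (@sub_finite_set _ _ ((fun w : n.-bseq I => prods w) @` setT)).
  move=> x /= lx; have [w [Ex E]] := len_word x.
  have wn : size w <= n by rewrite E.
  by exists (Bseq wn).
exact/finite_image/finite_finset.
Qed.

Lemma finite_par_bound J :
  finite_set (parabolic M J) -> exists n, forall x, J.-par x -> len x <= n.
Proof.
move=> fin; exists (\max_(x <- fset_set (parabolic M J)) len x) => x xJ.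
by apply: (@leq_bigmax_seq _ _ predT len x) => //; rewrite in_fset_set // inE.
Qed.

Lemma long_finite J l : long J l -> finite_set (parabolic M J).
Proof.
move=> L; apply: sub_finite_set (finite_len (len l)) => x xJ.
exact: long_le xJ.
Qed.

End Length.

(** * Conjugacy of involutions *)

Section Richardson.
Variables (I : finType) (M : coxeter_matrix I).

Local Notation W := (coxeter_group M).
Local Notation s := (simple_refl M).
Local Notation prods := (prods M).
Local Notation "J .-par" := (parabolic M J) (at level 2).
Implicit Types (i j k : I) (x y t u v l g : W) (J K : {set I}).

Definition cent_long J l := long J l /\ forall j, j \in J -> commute l (s j).

Lemma par_len1 J t : J.-par t -> len t = 1%N -> exists2 k, k \in J & t = s k.
Proof.
move=> /par_reduced [[|k [|k' w]] [wJ r ->]]; rewrite r //= => _.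
by move: wJ; rewrite /= andbT => kJ; exists k; rewrite ?mulg1.
Qed.

Lemma cent_long_comm J l x : cent_long J l -> J.-par x -> commute l x.
Proof.
move=> [_ cl] /parabolicP [w [/allP wJ ->]].
elim: w wJ => [|i w IH] wJ /=; first exact: commute1.
apply: commuteM; first by apply: cl; rewrite [_ \in _]wJ ?mem_head.
by apply: IH => k kw; apply: wJ; rewrite inE kw orbT.
Qed.

Lemma cent_long_neq1 J l : J != finset.set0 -> cent_long J l -> l <> 1.
Proof. by move=> /set0Pn [j jJ] [[_ /(_ j jJ)] + _] l1; rewrite l1 inv1. Qed.

(** By [long_len] applied to [l * s j], the conjugate has length [len l - len (l * s j) = 1]. *)
Lemma long_simple J l j :
  long J l -> j \in J -> exists2 k, k \in J & l * s j * l^-1 = s k.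
Proof.
move=> L jJ; apply: par_len1.
  exact: parM (parM L.1 (par_simple jJ)) (parV L.1).
have := long_len L (parM L.1 (par_simple jJ)).
rewrite invgM simpleV mulgA => E.
apply/eqP; rewrite -(eqn_add2r (len (l * s j))) {}E.
by rewrite (len_desc (L.2 j jJ)) add1n.
Qed.

(* In a conjugate [w] of minimal length every descent commutes with [w]; writing
   [w = v u] with [u] in the parabolic of the descents and [v] minimal in its coset,
   a descent of [v^-1] would be carried by [v] to an ascent of [v], so [v = 1]. *)
Lemma richardson x : x <> 1 -> x * x = 1 ->
  exists g J, J != finset.set0 /\ cent_long J (x ^ g).
Proof.
move=> x1 xx.
pose P n := `[< exists g, n = len (x ^ g) >].
have exP : exists n, P n by exists (len (x ^ 1)); apply/asboolP; exists 1.
have [_ /asboolP [g ->] minP] := ex_minnP exP.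
have {minP} : forall h, len (x ^ g) <= len ((x ^ g) ^ h).
  by move=> h; apply: minP; apply/asboolP; exists (g * h); rewrite conjgM.
have : x ^ g <> 1 by move/eqP; rewrite conjg_eq1 => /eqP.
have : x ^ g * x ^ g = 1 by rewrite -conjMg xx conj1g.
move Exg: (x ^ g) => w ww w1 min_w.
have wV : w^-1 = w by exact: mulg1_eq.
have comm i : inv w (s i) -> commute w (s i).
  move=> wi; have lsw : len (s i * w) < len w.
    by rewrite -lenV invgM wV simpleV inv_len.
  have := wi; rewrite -{1}(mulKs i w) invM inv_simple.
  have swi : inv (s i * w) (s i) = false.
    apply/negP => /inv_len lt_w; have := min_w (s i).
    by rewrite conjgE simpleV mulgA leqNgt (ltn_trans lt_w).
  rewrite swi addFb => /eqP.
  rewrite invgM simpleV wV mulgA => E.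
  have /mulg1_eq : s i * w * (s i * w) = 1.
    by apply: (mulIg (s i)); rewrite mul1g !mulgA E.
  by rewrite invgM simpleV wV.
pose J := [set i | inv w (s i)]%SET.
have [v [u [Ew uJ min_v]]] := minr_decomp J w.
have L : long J u.
  split=> // j jJ; rewrite -(minr_inv_mul min_v uJ jJ) -Ew.
  by rewrite inE in jJ.
have v1 : v = 1.
  apply/eqP/negP => /negP/eqP v1.
  have v1' : v^-1 <> 1 by move/eqP; rewrite invg_eq1 => /eqP.
  have [i _ vi] := par_desc (par_setT v^-1) v1'.
  have iJ : i \in J.
    rewrite inE inv_ltn -lenV invgM simpleV wV {1}Ew mulgA.
    apply: leq_ltn_trans (lenM _ _) _; rewrite Ew (minr_len min_v uJ) ltn_add2r.
    by rewrite -lenV invgM simpleV -[X in _ < X]lenV inv_len.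
  have wi : inv w (s i) by rewrite inE in iJ.
  have [k kJ Ek] := long_simple L iJ.
  have Ev : s i * v = v * s k.
    apply: (mulIg u); rewrite -mulgA -Ew -(comm i wi) Ew -Ek.
    by rewrite !mulgA mulgVK.
  have := inv_len vi; rewrite -{1}(simpleV M i) -invgM !lenV Ev.
  by rewrite (minr_len min_v (par_simple kJ)) ltnNge leq_addr.
move: Ew L; rewrite v1 mul1g => <- L.
exists g, J; rewrite Exg; split.
  have [i _ wi] := par_desc (par_setT w) w1.
  by apply/set0Pn; exists i; rewrite inE.
by split=> // j; rewrite inE => /comm.
Qed.

(** The descent [s j] of [g * l = l' * g] is not one of [g], so [g * s j * g^-1] is an inversion of
    [l'] and lies in [W_K]. Its length is 1 because [g * s j] has length [len g + 1], computed on
    either side. *)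
Lemma conj_cent_long_sub J K l l' g :
    cent_long J l -> cent_long K l' -> g * l = l' * g ->
    minr J g -> minr K g^-1 ->
  forall j, j \in J -> exists2 k, k \in K & g * s j * g^-1 = s k.
Proof.
move=> [L cl] [L' cl'] E mJ mK j jJ.
set t := g * s j * g^-1.
have tK : parabolic M K t.
  apply: inv_par L'.1 _.
  have := minr_inv_mul mJ L.1 jJ; rewrite E invM (L.2 j jJ).
  have := minr_inv_mul mJ (@par1 _ M J) jJ; rewrite mulg1 inv1 => ->.
  by rewrite addFb.
apply: par_len1 => //.
have := minr_len mK (parV tK); rewrite -invgM !lenV /t mulgVK.
rewrite (minr_len mJ (par_simple jJ)) len_simple => /eqP.
by rewrite eqn_add2l eq_sym => /eqP.
Qed.

(* A conjugating element of minimal length is minimal in both [h W_J] and [W_K h],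
   hence conjugates simple reflections to simple reflections. *)
Lemma conj_cent_long J K l l' g :
    cent_long J l -> cent_long K l' -> g * l = l' * g ->
  exists h, (forall j, j \in J -> exists2 k, k \in K & h * s j * h^-1 = s k) /\
            (forall k, k \in K -> exists2 j, j \in J & h^-1 * s k * h = s j).
Proof.
move=> C C' E.
pose P n := `[< exists2 h, h * l = l' * h & n = len h >].
have exP : exists n, P n by exists (len g); apply/asboolP; exists g.
have [_ /asboolP [h Eh ->] minP] := ex_minnP exP.
(* Multiplying [h] on the right by [W_J] or on the left by [W_K] keeps [h * l = l' * h], as [l] and
   [l'] are central there. *)
have mJ : minr J h.
  move=> u uJ; apply: minP; apply/asboolP; exists (h * u) => //.
  by rewrite -mulgA -(cent_long_comm C uJ) !mulgA Eh.
have mK : minr K h^-1.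
  move=> u uK; rewrite lenV -[len (_ * u)]lenV invgM invgK.
  apply: minP; apply/asboolP; exists (u^-1 * h) => //.
  by rewrite -mulgA Eh !mulgA (cent_long_comm C' (parV uK)).
exists h; split; first exact: conj_cent_long_sub C C' Eh mJ mK.
have := @conj_cent_long_sub K J l' l h^-1 C' C; rewrite invgK; apply=> //.
by apply: (mulgI h); rewrite mulVKg !mulgA Eh mulgK.
Qed.

Lemma conj_simple_par J K h :
    (forall j, j \in J -> exists2 k, k \in K & h * s j * h^-1 = s k) ->
  forall x, J.-par x -> K.-par (h * x * h^-1).
Proof.
move=> hJ _ /parabolicP [w [/allP wJ ->]].
elim: w wJ => [|i w IH] wJ /=; first by rewrite mulg1 mulgV; exact: par1.
have -> : h * (s i * prods w) * h^-1 = (h * s i * h^-1) * (h * prods w * h^-1).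
  by rewrite !mulgA mulgVK.
apply: parM; last by apply: IH => k kw; apply: wJ; rewrite inE kw orbT.
have [|k kK ->] := hJ i; last exact: par_simple.
by rewrite [_ \in _]wJ ?mem_head.
Qed.

Lemma conj_cent_long_iso J K l l' g :
    cent_long J l -> cent_long K l' -> g * l = l' * g ->
  isomorphic (parabolic M J) (parabolic M K).
Proof.
move=> C C' /(conj_cent_long C C') [h [hJ hK]].
exists (fun x => h * x * h^-1); split; last first.
  by move=> x y _ _; rewrite !mulgA mulgVK.
split.
- by move=> x; exact: conj_simple_par.
- by move=> x y _ _ /mulIg /mulgI.
- move=> x xK; exists (h^-1 * x * h); last by rewrite !mulgA mulgK mulgV mul1g.
  have := @conj_simple_par K J h^-1; rewrite invgK; exact.
Qed.

End Richardson.

(** * The geometric representation *)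

Section Chebyshev.
Local Open Scope R_scope.

(** Chebyshev polynomials of the second kind, [U_{k-1}(c / 2)]: the value is [sin (k a) / sin a] at
    [c = 2 cos a] with [sin a] nonzero, and [k] at [c = 2]. *)
Fixpoint cheb (c : R) (k : nat) : R :=
  match k with
  | 0%N => 0
  | S k' => match k' with 0%N => 1 | S k'' => c * cheb c k' - cheb c k'' end
  end.

Lemma chebSS c k : cheb c k.+2 = c * cheb c k.+1 - cheb c k.
Proof. by []. Qed.

Lemma cheb_sin a k :
  sin a * cheb (2 * cos a) k = sin (INR k * a) /\
  sin a * cheb (2 * cos a) k.+1 = sin (INR k.+1 * a).
Proof.
elim: k => [|k [IH1 IH2]]; first by split; rewrite /= ?Rmult_0_l ?Rmult_1_l ?sin_0; ring.
split=> //; rewrite chebSS Rmult_minus_distr_l IH1.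
rewrite -Rmult_assoc (Rmult_comm (sin a)) Rmult_assoc IH2 !S_INR.
have -> : (INR k + 1 + 1) * a = (INR k + 1) * a + a by ring.
have -> : INR k * a = (INR k + 1) * a - a by ring.
by rewrite sin_plus sin_minus; ring.
Qed.

Lemma cheb2 k : cheb 2 k = INR k /\ cheb 2 k.+1 = INR k.+1.
Proof.
elim: k => [|k [IH1 IH2]] //; split=> //.
by rewrite chebSS IH1 IH2 !S_INR; ring.
Qed.

(* Minus twice the inner product of two simple roots with label [m], the label 0
   being infinity. *)
Definition root_coef (m : nat) : R :=
  if m is 0%N then 2 else 2 * cos (PI / INR m).

Lemma INR_gt0 m : (0 < m)%N -> 0 < INR m.
Proof. by move=> m0; apply: lt_0_INR; apply/ltP. Qed.

Lemma root_coef1 : root_coef 1 = -2.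
Proof. by rewrite /root_coef /= Rdiv_1_r cos_PI; ring. Qed.

Lemma root_coef2 : root_coef 2 = 0.
Proof. by rewrite /root_coef -[INR 2]/2 cos_PI2; ring. Qed.

Lemma angle_bounds m k : (0 < k < m)%N -> 0 < INR k * (PI / INR m) < PI.
Proof.
move=> /andP [k0 km]; have m0 := ltn_trans k0 km.
have := PI_RGT_0; have := INR_gt0 m0; have := INR_gt0 k0.
have : INR k < INR m by apply: lt_INR; apply/ltP.
move=> hkm hk hm hpi; have hq : 0 < PI / INR m by apply: Rdiv_lt_0_compat.
split; first exact: Rmult_lt_0_compat.
have {2}-> : PI = INR m * (PI / INR m) by field; lra.
exact: Rmult_lt_compat_r.
Qed.

Lemma sin_angle_gt0 m : (1 < m)%N -> 0 < sin (PI / INR m).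
Proof.
move=> m1; have := @angle_bounds m 1; rewrite Rmult_1_l m1 => /(_ isT) [h1 h2].
exact: sin_gt_0.
Qed.

Lemma cheb_gt0 m k : (0 < k)%N -> m = 0%N \/ (k < m)%N -> 0 < cheb (root_coef m) k.
Proof.
move=> k0 [->|km]; first by rewrite (cheb2 k).1; exact: INR_gt0.
have m1 : (1 < m)%N by apply: leq_ltn_trans km.
have [hs hk] := (sin_angle_gt0 m1, (cheb_sin (PI / INR m) k).1).
have -> : root_coef m = 2 * cos (PI / INR m) by case: (m) m1.
have [h1 h2] : 0 < INR k * (PI / INR m) < PI by apply: angle_bounds; rewrite k0.
have := sin_gt_0 _ h1 h2; rewrite -hk => h.
by apply: (Rmult_lt_reg_l (sin (PI / INR m))) => //; rewrite Rmult_0_r.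
Qed.

Lemma cheb_ge0 m k : m = 0%N \/ (k <= m)%N -> (m <> 1)%N -> 0 <= cheb (root_coef m) k.
Proof.
move=> km m1; case: k km => [|k] km; first by right.
case: k km => [|k] km; first by rewrite /=; lra.
have [E|NE] := eqVneq k.+2 m; last first.
  by left; apply: cheb_gt0 => //; case: km => km; [left | right; rewrite ltn_neqAle NE].
right; have mE : root_coef m = 2 * cos (PI / INR m) by rewrite -E.
have := (cheb_sin (PI / INR m) m).1; rewrite -mE E.
have m0 : 0 < INR m by apply: INR_gt0; rewrite -E.
have -> : INR m * (PI / INR m) = PI by field; lra.
rewrite sin_PI => /Rmult_integral [|//].
by have := @sin_angle_gt0 m; rewrite -E => /(_ isT); lra.
Qed.

Lemma cheb_m m : (1 < m)%N ->
  cheb (root_coef m) m = 0 /\ cheb (root_coef m) m.+1 = -1.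
Proof.
move=> m1; have hs := sin_angle_gt0 m1.
have -> : root_coef m = 2 * cos (PI / INR m) by case: (m) m1.
have [] := cheb_sin (PI / INR m) m.
have m0 : 0 < INR m by apply: INR_gt0; apply: ltnW.
have -> : INR m * (PI / INR m) = PI by field; lra.
have -> : INR m.+1 * (PI / INR m) = PI / INR m + PI by rewrite S_INR; field; lra.
rewrite neg_sin sin_PI => h1 h2; split.
  by case: (Rmult_integral _ _ h1); lra.
by apply: (Rmult_eq_reg_l (sin (PI / INR m))); lra.
Qed.

(** The two equations say that the rotation by [2 k pi / m] is trivial: they force its cosine to be
    1, hence [sin (k pi / m) = 0]. For infinite label the first value is [2 k]. *)
Lemma cheb_order m k : (0 < k)%N -> m = 0%N \/ (k < m)%N ->
  ~ (cheb (root_coef m) k.*2 = 0 /\ cheb (root_coef m) k.*2.+1 = 1).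
Proof.
move=> k0 [->|km].
  rewrite (cheb2 _).1 => [] [h _]; have := @INR_gt0 k.*2; rewrite double_gt0 k0.
  by move=> /(_ isT); lra.
have m1 : (1 < m)%N by apply: leq_ltn_trans km.
have hs := sin_angle_gt0 m1.
have -> : root_coef m = 2 * cos (PI / INR m) by case: (m) m1.
have [] := cheb_sin (PI / INR m) k.*2.
set a := PI / INR m in hs *; move=> h1 h2 [e1 e2]; move: h1 h2; rewrite e1 e2.
rewrite S_INR Rmult_plus_distr_r Rmult_1_l sin_plus => <-.
rewrite !Rmult_0_r Rmult_0_l Rplus_0_l Rmult_1_r => h.
have c1 : cos (INR k.*2 * a) = 1 by apply: (Rmult_eq_reg_r (sin a)); lra.
have : cos (2 * (INR k * a)) = 1.
  by rewrite -c1 -mul2n mult_INR; congr cos; rewrite -[INR 2]/2; ring.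
rewrite cos_2a_sin => h3.
have [h4 h5] : 0 < INR k * a < PI by apply: angle_bounds; rewrite k0.
have := sin_gt_0 _ h4 h5 => h6.
have : 0 < sin (INR k * a) * sin (INR k * a) by exact: Rmult_lt_0_compat.
lra.
Qed.

End Chebyshev.

(** * Alternating products of two involutions *)

Section Alternation.
Variables (X : Type).
Implicit Types (a b : X -> X) (x : X).

Fixpoint alt k a b x : X := if k is k'.+1 then a (alt k' b a x) else x.

Fixpoint alt_inner k a b x : X := if k is k'.+1 then alt_inner k' b a (a x) else x.

Lemma iter_alt k a b x :
  iter k (fun y => a (b y)) x = alt k a b (alt_inner k b a x).
Proof.
elim: k a b x => [|k IH] a b x //; rewrite [RHS]/= -IH.
by elim: k {IH} => [|k IH] //; rewrite iterS IH.
Qed.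

Lemma altK a b k : (forall y, a (a y) = y) -> (forall y, b (b y) = y) ->
  forall x, alt k a b (alt_inner k a b x) = x.
Proof. by elim: k a b => [|k IH] a b aK bK x //=; rewrite IH. Qed.

(** An alternating word of [2 m] letters is an outer half times an inner half, and the latter
    inverts the outer half with the letters exchanged. So the braid relation of length [m] gives the
    Coxeter relation. *)
Lemma alt_braid_iter m a b : (forall y, a (a y) = y) -> (forall y, b (b y) = y) ->
    (forall y, alt m a b y = alt m b a y) ->
  forall x, iter m (fun y => a (b y)) x = x.
Proof. by move=> aK bK E x; rewrite iter_alt E altK. Qed.

End Alternation.

(** * The action on linear forms, exact orders and positivity *)

Section GeometricAction.
Variables (I : finType) (M : coxeter_matrix I).

Local Notation W := (coxeter_group M).
Local Notation s := (simple_refl M).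
Local Notation prods := (prods M).
Local Notation "J .-par" := (parabolic M J) (at level 2).
Local Notation cf i j := (root_coef (M i j)).
Implicit Types (i j : I) (x y z t u v : W) (J K C : {set I}) (f : I -> R).

(* [f] is a linear form, recorded by its values on the simple roots. *)
Definition rrefl i f : I -> R := fun j => (f j + cf i j * f i)%Re.

Lemma rrefl_self i f : rrefl i f i = (- f i)%Re.
Proof. by rewrite /rrefl cox_diag root_coef1; ring. Qed.

Lemma rreflK i f : rrefl i (rrefl i f) = f.
Proof.
apply/funext => j; rewrite {1}/rrefl rrefl_self /rrefl; ring.
Qed.

Section Rank2.
Variables (i j : I).
Local Notation U := (cheb (cf i j)).

Definition alt_spec i j f k :=
  alt k (rrefl j) (rrefl i) f i =
  if odd k then (U k.+1 * f j + U k * f i)%Re else (U k.+1 * f i + U k * f j)%Re.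

(** The roots of a dihedral subsystem have coefficients [U k.+1] and [U k] in the two simple roots.
    The recursion exchanges [i] and [j] and has order two, hence the joint induction on both orders
    and two consecutive indices. *)
Lemma alt_val f k : alt_spec i j f k /\ alt_spec j i f k.
Proof.
suff H : (alt_spec i j f k /\ alt_spec j i f k) /\
         (alt_spec i j f k.+1 /\ alt_spec j i f k.+1) by case: H.
elim: k => [|k [[IH1 IH1'] [IH2 IH2']]].
  rewrite /alt_spec /= /rrefl (@cox_sym _ M j i).
  by split; split; ring.
split; first by [].
have E1 (a b : I) : alt k.+2 (rrefl b) (rrefl a) f a =
    (- alt k (rrefl b) (rrefl a) f a + cf b a * alt k.+1 (rrefl a) (rrefl b) f b)%Re.
  by rewrite [LHS]/= {1}/rrefl rrefl_self.
split; rewrite /alt_spec E1.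
  rewrite IH1 IH2' (@cox_sym _ M j i) !chebSS /=.
  by case: (odd k) => /=; ring.
rewrite IH1' IH2 !chebSS /=.
by case: (odd k) => /=; ring.
Qed.

(** At [k = M i j] the factor [U k] vanishes, which is the braid relation at every simple root [l],
    not only at [i] and [j]. *)
Lemma alt_diff f k l :
  (alt k (rrefl j) (rrefl i) f l - alt k (rrefl i) (rrefl j) f l =
   U k * if odd k then f j * cf j l - f i * cf i l
         else f i * cf j l - f j * cf i l)%Re.
Proof.
elim: k => [|k IH]; first by rewrite /=; ring.
have rE a (g : I -> R) : rrefl a g l = (g l + cf a l * g a)%Re by [].
rewrite /= !rE.
have [E1 E2] := alt_val f k.
have -> : alt k (rrefl i) (rrefl j) f j =
  if odd k then (U k.+1 * f i + U k * f j)%Re else (U k.+1 * f j + U k * f i)%Re.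
  exact: E2.
have -> : alt k (rrefl j) (rrefl i) f i =
  if odd k then (U k.+1 * f j + U k * f i)%Re else (U k.+1 * f i + U k * f j)%Re.
  exact: E1.
have -> : alt k (rrefl i) (rrefl j) f l = (alt k (rrefl j) (rrefl i) f l -
   U k * if odd k then f j * cf j l - f i * cf i l
         else f i * cf j l - f j * cf i l)%Re.
  by rewrite -IH; ring.
by rewrite -/(cheb _ k.+1); case: (odd k); rewrite /=; ring.
Qed.

End Rank2.

Lemma off_diag_gt1 i j : i != j -> M i j <> 0 -> 1 < M i j.
Proof. by move=> ij; have := @cox_off_diag _ M _ _ ij; case: (M i j) => [|[|]]. Qed.

Lemma rrefl_rel i j : M i j <> 0 ->
  forall f, iter (M i j) (fun f => rrefl i (rrefl j f)) f = f.
Proof.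
move=> Mij; have [<-|ij] := eqVneq i j; first by move=> f; rewrite cox_diag /= rreflK.
apply: alt_braid_iter; [exact: rreflK|exact: rreflK|move=> f].
apply/funext => l; apply: Rminus_diag_uniq.
by rewrite alt_diff cox_sym (cheb_m (off_diag_gt1 ij Mij)).1; ring.
Qed.

Definition gact x f : I -> R := cact rrefl x f.

Lemma gactM x y f : gact (x * y) f = gact x (gact y f).
Proof. exact: (cactM rrefl_rel). Qed.

Lemma gact1 f : gact 1 f = f.
Proof. exact: (cact1 rrefl_rel). Qed.

Lemma gact_simple i f : gact (s i) f = rrefl i f.
Proof. exact: (cact_simple rrefl_rel). Qed.

Lemma gactK x f : gact x (gact x^-1 f) = f.
Proof. by rewrite -gactM mulgV gact1. Qed.

(** The alternating word of [k] letters with prescribed last letter [s j], since descents are taken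
    on the right. *)
Fixpoint dih k i j : W := if k is k'.+1 then dih k' j i * s j else 1.

Lemma dih_len k i j : len (dih k i j) <= k.
Proof.
elim: k i j => [|k IH] i j /=; first by rewrite len1.
by apply: leq_trans (lenM _ _) _; rewrite len_simple addn1 ltnS.
Qed.

Lemma gact_dihV k i j f : gact (dih k i j)^-1 f = alt k (rrefl j) (rrefl i) f.
Proof.
elim: k i j => [|k IH] i j /=; first by rewrite invg1 gact1.
by rewrite invgM simpleV gactM gact_simple IH.
Qed.

Lemma dih_double k i j : dih k.*2 i j = (s i * s j) ^+ k.
Proof. by elim: k => [|k IH] //; rewrite doubleS expgSr /= IH !mulgA. Qed.

Lemma dih_braid k i j : (dih k i j)^-1 * dih k j i = (s j * s i) ^+ k.
Proof.
elim: k i j => [|k IH] i j /=; first by rewrite invg1 mulg1.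
rewrite invgM simpleV -!mulgA (mulgA (dih k j i)^-1) IH expgS mulgA.
by elim: k {IH} => [|k IH]; rewrite ?mulg1 // !expgSr !mulgA IH.
Qed.

(** The relations only bound the order from above. A trivial power would fix the forms equal to 1 at
    [i], respectively at [j], and 0 elsewhere; their values at [i] give the equations excluded by
    [cheb_order]. *)
Lemma simple_order i j k : i != j -> 0 < k -> M i j = 0 \/ k < M i j ->
  (s i * s j) ^+ k <> 1.
Proof.
move=> ij k0 kM E; apply: (cheb_order k0 kM).
have H f : (cheb (cf i j) k.*2.+1 * f i + cheb (cf i j) k.*2 * f j = f i)%Re.
  have := (alt_val i j f k.*2).1; rewrite /alt_spec odd_double => <-.
  by rewrite -gact_dihV dih_double E invg1 gact1.
have := H (fun l => if l == i then 1%Re else 0%Re).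
have := H (fun l => if l == j then 1%Re else 0%Re).
rewrite !eqxx (negbTE ij) eq_sym (negbTE ij) => h1 h2.
by split; lra.
Qed.

Lemma simple_inj : injective s.
Proof.
move=> i j E; apply/eqP/negP => /negP ij; apply: (@simple_order i j 1 ij) => //.
  have := @cox_off_diag _ M _ _ ij; case: (M i j) => [|[|m]] //; [by left | by right].
by rewrite expg1 E simpleK.
Qed.

Lemma simple_commute i j : i != j -> commute (s i) (s j) -> M i j = 2.
Proof.
move=> ij c; have E : (s i * s j) ^+ 2 = 1.
  by rewrite expg2 {2}c -!mulgA mulKs simpleK.
have := @cox_off_diag _ M _ _ ij; case Mij: (M i j) => [|[|[|m]]] // _.
  by case: (simple_order ij _ _ E) => //; left.
by case: (simple_order ij _ _ E) => //; right; rewrite Mij.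
Qed.

Lemma commute_simple i j : M i j = 2 -> commute (s i) (s j).
Proof.
move=> Mij; have : (s i * s j) ^+ 2 = 1 by rewrite -Mij simple_rel // Mij.
by rewrite expg2 => /mulg1_eq; rewrite invgM !simpleV /commute => ->.
Qed.

Lemma par_simple_mem J i : J.-par (s i) -> i \in J.
Proof. by move=> /par_len1 /(_ (len_simple M i)) [k kJ /simple_inj ->]. Qed.

Lemma dih_par k i j : parabolic M [set i; j]%SET (dih k i j).
Proof.
elim: k i j => [|k IH] i j /=; first exact: par1.
apply: parM; first by rewrite finset.setUC; exact: IH.
by apply: par_simple; rewrite !inE eqxx orbT.
Qed.

(** The bound is strict because an alternating word of [M i j] letters can be rewritten by the braid
    relation to end in [s i], which is an ascent of [z]. It keeps the Chebyshev coefficients in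
    [tits_pos] nonnegative. *)
Lemma dihedral_word i j z : i != j -> parabolic M [set i; j]%SET z ->
    inv z (s i) = false ->
  exists k, [/\ z = dih k i j, len z = k & M i j = 0 \/ k < M i j].
Proof.
have [n] := ubnP (len z); elim: n i j z => // n IH i j z lt_z ij zJ zi.
have [z1|z1] := pselect (z = 1).
  exists 0; rewrite z1 len1; split=> //.
  by case: (M i j); [left | right].
have [k] := par_desc zJ z1; rewrite !inE => /orP [] /eqP -> zk.
  by rewrite zk in zi.
have lz := len_desc zk.
have [||||k' [E lk km]] := IH j i (z * s j).
- by rewrite -ltnS -lz.
- by rewrite eq_sym.
- by rewrite finset.setUC; apply: parM => //; apply: par_simple; rewrite !inE eqxx orbT.
- by rewrite inv_mul_simple zk.
have Ez : z = dih k'.+1 i j by rewrite /= -E mulsK.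
exists k'.+1; split=> //; first by rewrite lz lk.
have [Mij|Mij] := eqVneq (M i j) 0; [by left | right].
move: km; rewrite cox_sym => -[/eqP|km]; first by rewrite (negbTE Mij).
rewrite ltn_neqAle km andbT; apply/eqP => kM.
have Ebr : dih (M i j) i j = dih (M i j) j i.
  apply: (mulgI (dih (M i j) i j)^-1); rewrite mulVg dih_braid cox_sym.
  by rewrite simple_rel // cox_sym; apply/eqP.
have : len (z * s i) <= k'.
  by rewrite Ez kM Ebr -kM /= mulsK dih_len.
by rewrite len_asc // lz lk ltnNge leqnSn.
Qed.

(* Tits' positivity of roots, [f] ranging over the dominant chamber: the root
   [x alpha_i] is positive when [s i] is not a descent of [x]. *)
Lemma tits_pos x i f : (forall l, 0 <= f l)%Re -> inv x (s i) = false ->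
  (0 <= gact x^-1 f i)%Re.
Proof.
move=> f0; have [n] := ubnP (len x); elim: n x i => // n IH x i lt_x xi.
have [->|x1] := pselect (x = 1); first by rewrite invg1 gact1.
have [j _ xj] := par_desc (par_setT x) x1.
have ij : i != j by apply/eqP => E; move: xi; rewrite E xj.
have [v [z [Ex zJ min_v]]] := minr_decomp [set i; j]%SET x.
have [iJ jJ] : i \in [set i; j]%SET /\ j \in [set i; j]%SET.
  by rewrite !inE !eqxx orbT.
have zi : inv z (s i) = false by rewrite -(minr_inv_mul min_v zJ iJ) -Ex.
have zj : inv z (s j) by rewrite -(minr_inv_mul min_v zJ jJ) -Ex.
have lt_v : len v < n.
  rewrite -ltnS; apply: leq_trans lt_x; rewrite ltnS Ex (minr_len min_v zJ).
  by rewrite (len_desc zj) addnS ltnS leq_addr.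
have v_asc k : k \in [set i; j]%SET -> inv v (s k) = false.
  by move=> kJ; rewrite -[v]mulg1 (minr_inv_mul min_v (@par1 _ M _) kJ) inv1.
have gi := IH _ _ lt_v (v_asc i iJ); have gj := IH _ _ lt_v (v_asc j jJ).
have [k [Ez _ km]] := dihedral_word ij zJ zi.
rewrite Ex invgM gactM; move: (gact _ f) gi gj => g gi gj.
rewrite Ez gact_dihV (alt_val i j g k).1.
have M1 := @cox_off_diag _ M _ _ ij.
have U0 : (0 <= cheb (cf i j) k)%Re.
  by apply: cheb_ge0 => //; case: km => [|/ltnW]; auto.
have U1 : (0 <= cheb (cf i j) k.+1)%Re by apply: cheb_ge0.
by case: (odd k); apply: Rplus_le_le_0_compat; apply: Rmult_le_pos.
Qed.

(** Thus [W_J] acts on forms restricted to [J], where being -1 or the identity is tested. *)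
Lemma gact_local J x f g : J.-par x -> (forall j, j \in J -> f j = g j) ->
  forall j, j \in J -> gact x f j = gact x g j.
Proof.
move=> /parabolicP [w [/allP wJ ->]] fg.
elim: w wJ => [|i w IH] wJ /= j jJ; first by rewrite !gact1 fg.
have iJ : i \in J := wJ i (mem_head i w).
have {}IH := IH (fun k kw => wJ k (mem_behead (s := i :: w) kw)).
by rewrite !gactM !gact_simple /rrefl !IH.
Qed.

(** If [s j] is a descent of [x^-1], positivity at [x^-1 * s j] on the constant form 1 would make -1
    nonnegative. *)
Lemma gact_faithful J x : J.-par x ->
  (forall f j, j \in J -> gact x f j = f j) -> x = 1.
Proof.
move=> xJ E; apply/eqP; rewrite -invg_eq1; apply/eqP; apply: contrapT => x1.
have [j jJ xj] := par_desc (parV xJ) x1.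
have := @tits_pos (x^-1 * s j) j (fun=> 1%Re).
rewrite inv_mul_simple xj invgM simpleV invgK gactM gact_simple rrefl_self E //.
by move=> /(_ (fun=> Rle_0_1) erefl); lra.
Qed.

(** The criterion behind all finite types. Acting as -1 makes every simple root of [J] negative, so
    each is a descent by positivity; and -1 commutes with reflections, which faithfulness transfers
    to the group. *)
Lemma cent_long_neg J x : J.-par x ->
  (forall f j, j \in J -> gact x f j = - f j)%Re -> cent_long J x.
Proof.
move=> xJ E; split; first split=> // j jJ.
  apply: contraT => /negbTE /(tits_pos (f := fun=> 1%Re) (fun=> Rle_0_1)).
  have := E (gact x^-1 (fun=> 1%Re)) j jJ; rewrite gactK; lra.
move=> j jJ; have sJ : J.-par (s j) by exact: par_simple.
have : (s j * x)^-1 * (x * s j) = 1.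
  apply: (gact_faithful (J := J)); first exact: parM (parV (parM sJ xJ)) (parM xJ sJ).
  move=> f k kJ; rewrite gactM.
  rewrite (gact_local (J := J) (g := gact (s j * x) f)) //.
  - by rewrite -gactM mulVg gact1.
  - exact: parV (parM sJ xJ).
  - move=> l lJ; rewrite !gactM !gact_simple E // /rrefl !E //; ring.
by move/mulg1_eq; rewrite invgK => E2; rewrite /commute E2.
Qed.

(** The half turn: at [m = M i j] the coefficients are [U m = 0] and [U m.+1 = -1], and for even [m]
    they give -1 at both simple roots. *)
Lemma cent_long_dihedral i j : i != j -> M i j <> 0 -> ~~ odd (M i j) ->
  exists l, @cent_long _ M [set i; j]%SET l.
Proof.
move=> ij M0 ev; exists (dih (M i j) i j)^-1; apply: cent_long_neg.
  by apply: parV; exact: dih_par.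
have [U0 U1] := cheb_m (off_diag_gt1 ij M0).
have Ebr : dih (M i j) i j = dih (M i j) j i.
  apply: (mulgI (dih (M i j) i j)^-1); rewrite mulVg dih_braid cox_sym.
  by rewrite simple_rel // cox_sym.
move=> f k; rewrite !inE => /orP [] /eqP ->.
  by rewrite gact_dihV (alt_val i j f _).1 (negbTE ev) U0 U1; ring.
by rewrite Ebr gact_dihV (alt_val i j f _).2 (negbTE ev) U0 U1; ring.
Qed.

Lemma cent_long1 i : cent_long [set i]%SET (s i).
Proof.
by split; [split; [apply: par_simple; rewrite inE | move=> j; rewrite inE => /eqP ->;
  rewrite inv_simple] | move=> j; rewrite inE => /eqP ->].
Qed.

Lemma cent_long0 : cent_long finset.set0 (1 : W).
Proof. by split; [split; [exact: par1|]|] => j; rewrite inE. Qed.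

(** Inversions of an element of one factor stay in that factor, so the other factor does not disturb
    its descents. *)
Lemma cent_long_prod J K (l l' : W) : (forall j k, j \in J -> k \in K -> j != k /\ M j k = 2) ->
  cent_long J l -> cent_long K l' -> cent_long (J :|: K)%SET (l * l').
Proof.
move=> JK C C'; have [[lJ dl] cl] := C; have [[lK dl'] cl'] := C'.
have comm x y : J.-par x -> K.-par y -> commute x y.
  move=> /parabolicP [w [/allP wJ ->]] /parabolicP [w' [/allP wK ->]].
  elim: w wJ => [|i w IH] wJ /=; first exact/commute_sym/commute1.
  have {}IH := IH (fun k kw => wJ k (mem_behead (s := i :: w) kw)).
  have iJ : i \in J := wJ i (mem_head i w).
  apply/commute_sym/commuteM; last exact/commute_sym.
  apply/commute_sym; elim: w' wK {IH} => [|k w' IH] wK /=; first exact: commute1.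
  apply: commuteM; last by apply: IH => k' kw; apply: wK; rewrite inE kw orbT.
  exact/commute_simple/(JK _ _ iJ (wK k (mem_head k w'))).2.
have asc (A B : {set I}) y i : (forall j k, j \in A -> k \in B -> j != k) -> B.-par y -> i \in A ->
    inv y (s i) = false.
  move=> AB yB iA; apply/negP => /(inv_par yB) /par_simple_mem /(AB i i iA).
  by rewrite eqxx.
have par_l : (J :|: K)%SET.-par l by apply: parS lJ; exact: finset.subsetUl.
have par_l' : (J :|: K)%SET.-par l' by apply: parS lK; exact: finset.subsetUr.
split; first split; first exact: parM.
  move=> i; rewrite inE => /orP [iJ|iK].
    rewrite (comm _ _ lJ lK) invM dl // (cl _ iJ) mulgK.
    by rewrite (asc J K) // => j k jJ kK; case: (JK j k).
  rewrite invM dl' // (cl' _ iK) mulgK.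
  by rewrite (asc K J) // => j k jJ kK; rewrite eq_sym; case: (JK k j).
move=> i; rewrite inE => /orP [iJ|iK]; apply/commute_sym/commuteM; apply/commute_sym.
- exact: cl.
- by apply: commute_sym; apply: comm => //; exact: par_simple.
- by apply: comm => //; exact: par_simple.
- exact: cl'.
Qed.

Lemma conj_cent_long_card J K (l l' g : W) :
    cent_long J l -> cent_long K l' -> g * l = l' * g -> #|J| = #|K|.
Proof.
move=> C C' E; have [h [hJ hK]] := conj_cent_long C C' E.
have leq (A B : {set I}) (r : W) :
    (forall j, j \in A -> exists2 k, k \in B & r * s j * r^-1 = s k) -> #|A| <= #|B|.
  move=> H; have /choice [F HF] : forall j, exists k, j \in A ->
      k \in B /\ r * s j * r^-1 = s k.
    move=> j; case jA: (j \in A); last by exists j.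
    by have [k kB Ek] := H j jA; exists k.
  rewrite -(@card_in_imset _ _ F A).
    by apply: subset_leq_card; apply/fintype.subsetP => _ /imsetP [j jA ->]; case: (HF j jA).
  move=> j k jA kA; have [_ +] := HF j jA; have [_ +] := HF k kA => + + EF.
  by rewrite EF => <- /mulIg /mulgI /simple_inj.
apply/eqP; rewrite eqn_leq (leq _ _ h) //=; apply: (leq _ _ h^-1) => k /hK.
by rewrite invgK.
Qed.

End GeometricAction.

(** * Diagrams of finite type with central longest element *)

Section RootCoefValues.
Local Open Scope R_scope.

(** Here and for labels 4 and 5, [root_coef m] is identified algebraically, as a zero of [cheb _ m]
    at which earlier values are positive. *)
Lemma root_coef3 : root_coef 3 = 1.
Proof.
have [E _] := @cheb_m 3 isT; have := @cheb_gt0 3 2 isT (or_intror isT).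
by move: E; rewrite !chebSS [cheb _ 1]/= [cheb _ 0]/=; nra.
Qed.

Lemma root_coef4 : root_coef 4 * root_coef 4 = 2 /\ 0 < root_coef 4.
Proof.
have [E _] := @cheb_m 4 isT; have := @cheb_gt0 4 2 isT (or_intror isT).
move: E; rewrite !chebSS [cheb _ 1]/= [cheb _ 0]/=; set c := root_coef 4.
move=> E h; split; last lra.
apply: Rminus_diag_uniq; apply: (Rmult_eq_reg_l c); lra.
Qed.

Lemma root_coef5 : root_coef 5 * root_coef 5 = root_coef 5 + 1.
Proof.
have [E _] := @cheb_m 5 isT; have := @cheb_gt0 5 2 isT (or_intror isT).
have := @cheb_gt0 5 4 isT (or_intror isT).
move: E; rewrite !chebSS [cheb _ 1]/= [cheb _ 0]/=; set c := root_coef 5.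
move=> E h4 h2; have c0 : 0 < c by lra.
have c2 : 0 < c * c - 2.
  by apply: (Rmult_lt_reg_l c) => //; lra.
have : (c * c - c - 1) * (c * c + c - 1) = 0 by lra.
by case/Rmult_integral; lra.
Qed.

End RootCoefValues.

(** * Exact matrix computation in a quadratic ring *)

Section QuadraticComputation.
Variables (p q : Z).
Local Open Scope Z_scope.

(* Matrices over [Z[X]/(X^2 - p X - q)]; [(a, b)] stands for [a + b X]. *)
Definition qmul (a b : Z * Z) : Z * Z :=
  (a.1 * b.1 + q * (a.2 * b.2), a.1 * b.2 + a.2 * b.1 + p * (a.2 * b.2)).

Definition qadd (a b : Z * Z) : Z * Z := (a.1 + b.1, a.2 + b.2).

Fixpoint axpy (c : Z * Z) (r r' : seq (Z * Z)) : seq (Z * Z) :=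
  match r, r' with
  | a :: r1, b :: r1' => qadd a (qmul c b) :: axpy c r1 r1'
  | [::], _ => map (qmul c) r'
  | _, [::] => r
  end.

(** The default case is the single label above 3 allowed in the diagram; its coefficient is the
    generator [X]. *)
Definition qcoef (m : nat) : Z * Z :=
  match m with 1%N => (-2, 0) | 2%N => (0, 0) | 3%N => (1, 0) | _ => (0, 1) end.

Definition unit_rows (u : Z) (n : nat) : seq (seq (Z * Z)) :=
  mkseq (fun a => mkseq (fun k => (if k == a then u else 0, 0)) n) n.

Definition refl_rows (L : nat -> nat -> nat) n i (st : seq (seq (Z * Z))) :=
  mkseq (fun a => axpy (qcoef (L i a)) (nth [::] st a) (nth [::] st i)) n.

Definition word_rows L n (w : seq nat) :=
  foldr (refl_rows L n) (unit_rows 1 n) w.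

Variable X : R.
Local Open Scope R_scope.
Hypothesis XX : X * X = IZR p * X + IZR q.

Definition qval (a : Z * Z) : R := IZR a.1 + IZR a.2 * X.

Lemma qval_mul a b : qval (qmul a b) = qval a * qval b.
Proof.
rewrite /qval /qmul /= !plus_IZR !mult_IZR.
have -> : (IZR a.1 + IZR a.2 * X) * (IZR b.1 + IZR b.2 * X) =
  IZR a.1 * IZR b.1 + (IZR a.1 * IZR b.2 + IZR a.2 * IZR b.1) * X
  + IZR a.2 * IZR b.2 * (X * X) by ring.
by rewrite XX; ring.
Qed.

Lemma qval_add a b : qval (qadd a b) = qval a + qval b.
Proof. by rewrite /qval /= !plus_IZR; ring. Qed.

Fixpoint row_val (r : seq (Z * Z)) (k : nat) (g : nat -> R) : R :=
  if r is a :: r' then qval a * g k + row_val r' k.+1 g else 0.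

Lemma row_val_axpy c r r' k g :
  row_val (axpy c r r') k g = row_val r k g + qval c * row_val r' k g.
Proof.
elim: r r' k => [|a r IH] [|b r'] k /=; try ring.
  rewrite qval_mul.
  have -> : row_val [seq qmul c i | i <- r'] k.+1 g = qval c * row_val r' k.+1 g.
    by elim: r' (k.+1) => [|d r' IH] j /=; rewrite ?qval_mul ?IH; ring.
  by ring.
by rewrite qval_add qval_mul IH; ring.
Qed.

Lemma row_val_unit u a m n g :
  row_val [seq (if k == a then u else 0%Z, 0%Z) | k <- iota m n] m g =
  if (m <= a < m + n)%N then IZR u * g a else 0.
Proof.
elim: n m => [|n IH] m /=.
  by case: ifP => // /andP [h1 h2]; move: (leq_ltn_trans h1 h2); rewrite addn0 ltnn.
rewrite IH /qval /= addSnnS; have [lt|gt|<-] := ltngtP m a => /=.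
- by case: ifP => _; ring.
- by ring.
- by rewrite addnS ltnS leq_addr; ring.
Qed.

Lemma nth_unit_rows u n a g : (a < n)%N ->
  row_val (nth [::] (unit_rows u n) a) 0 g = IZR u * g a.
Proof. by move=> an; rewrite nth_mkseq // /mkseq row_val_unit leq0n add0n an. Qed.

Variables (I : finType) (M : coxeter_matrix I) (n : nat) (e : nat -> I).
Variables (L : nat -> nat -> nat) (m : nat).
Hypotheses (ML : forall a b, (a < n)%N -> (b < n)%N -> M (e a) (e b) = L a b)
  (Xm : root_coef m = X)
  (Lm : all (fun a => all (fun b => L a b \in [:: 1%N; 2%N; 3%N; m]) (iota 0 n)) (iota 0 n))
  (m4 : (3 < m)%N).

Lemma qval_coef a b : (a < n)%N -> (b < n)%N ->
  qval (qcoef (L a b)) = root_coef (M (e a) (e b)).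
Proof.
move=> an bn; rewrite ML //; move: Lm => /allP /(_ a).
rewrite mem_iota /= add0n => /(_ an) /allP /(_ b).
rewrite mem_iota /= add0n => /(_ bn); rewrite !inE.
case/or4P=> /eqP ->; rewrite ?root_coef1 ?root_coef2 ?root_coef3 /qval /=; try ring.
by rewrite Xm; case: (m) m4 => [|[|[|[|k]]]] //= _; ring.
Qed.

Lemma word_rows_val w a f : all (gtn n) w -> (a < n)%N ->
  gact (prods M (map e w)) f (e a) =
  row_val (nth [::] (word_rows L n w) a) 0 (fun k => f (e k)).
Proof.
elim: w a => [|i w IH] a /=; first by move=> _ an; rewrite gact1 nth_unit_rows // Rmult_1_l.
move=> /andP [ltin wn] an.
rewrite gactM gact_simple /rrefl !IH // nth_mkseq // row_val_axpy qval_coef //.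
Qed.

(** Turns acting as -1 into an equality of integer matrices, which evaluation decides for a concrete
    word. *)
Lemma cent_long_word_rows (J : {set I}) w : all (gtn n) w ->
    (forall x, x \in J <-> exists2 a, (a < n)%N & x = e a) ->
    word_rows L n w = unit_rows (-1) n ->
  exists l : coxeter_group M, cent_long J l.
Proof.
move=> wn JE E; exists (prods M (map e w)); apply: cent_long_neg.
  apply: par_prods; rewrite all_map; apply/allP => i /(allP wn) ltin /=.
  by apply/JE; exists i.
move=> f j /JE [a an ->]; rewrite word_rows_val // E nth_unit_rows //; ring.
Qed.

End QuadraticComputation.

(** * Types B and D by sign changes of coordinates *)

Section SignChanges.
Variables (I : finType) (M : coxeter_matrix I) (n : nat) (e : nat -> I).
Variables (J : {set I}) (last_form : (nat -> R) -> R).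
Local Notation gact := (@gact I M).
Local Notation s := (simple_refl M).
Local Open Scope R_scope.

(* [y] lists the coordinates, in an orthogonal basis, of the form with values [f] at
   the simple roots [e a]: the roots are the [y a - y (a + 1)] and [last_form y]. *)
Definition coords (f : I -> R) (y : nat -> R) :=
  (forall a, (a.+1 < n)%N -> f (e a) = y a - y a.+1) /\ f (e n.-1) = last_form y.

Definition swap_idx (a k : nat) : nat :=
  if k == a then a.+1 else if k == a.+1 then a else k.

Definition sign_flip (S : nat -> bool) (y : nat -> R) : nat -> R :=
  fun k => if S k then - y k else y k.

Hypotheses (n0 : (0 < n)%N)
  (JE : forall x, x \in J <-> exists2 a, (a < n)%N & x = e a)
  (ex_coords : forall f, exists y, coords f y)
  (last_formN : forall y, last_form (fun k => - y k) = - last_form y)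
  (last_form_ext : forall y y', (forall k, (k < n)%N -> y k = y' k) ->
     last_form y = last_form y')
  (coords_swap : forall a f y, (a.+1 < n)%N -> coords f y ->
     coords (rrefl M (e a) f) (fun k => y (swap_idx a k))).

Lemma coords_ext f y y' : (forall k, (k < n)%N -> y k = y' k) ->
  coords f y -> coords f y'.
Proof.
move=> E [H1 H2]; split=> [a an|]; last by rewrite H2; exact: last_form_ext.
by rewrite H1 // !E // ltnW.
Qed.

(** The sign changes realised in [W_J]: products give symmetric differences, conjugation by swaps
    moves the indices, and the full set is -1. *)
Definition flippable S := exists2 x, parabolic M J x &
  forall f y, coords f y -> coords (gact x f) (sign_flip S y).

Lemma flippable_ext S S' : (forall k, (k < n)%N -> S k = S' k) ->
  flippable S -> flippable S'.
Proof.
move=> E [x xJ H]; exists x => // f y /H; apply: coords_ext => k kn.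
by rewrite /sign_flip E.
Qed.

Lemma flippable0 : flippable (fun=> false).
Proof. by exists 1%g => [|f y]; [exact: par1 | rewrite gact1]. Qed.

Lemma flippable_add S S' : flippable S -> flippable S' ->
  flippable (fun k => S k (+) S' k).
Proof.
move=> [x xJ H] [x' xJ' H']; exists (x * x')%g; first exact: parM.
move=> f y /H'/H; rewrite gactM; apply: coords_ext => k _; rewrite /sign_flip.
by case: (S k); case: (S' k) => //=; ring.
Qed.

Lemma flippable_swap a S : (a.+1 < n)%N -> flippable S ->
  flippable (fun k => S (swap_idx a k)).
Proof.
move=> an [x xJ H]; have eJ : parabolic M J (s (e a)).
  by apply: par_simple; apply/JE; exists a => //; exact: ltnW.
exists (s (e a) * x * s (e a))%g; first exact: parM (parM eJ xJ) eJ.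
move=> f y /(coords_swap an)/H/(coords_swap an).
rewrite !gactM !gact_simple; apply: coords_ext => k _.
have E : swap_idx a (swap_idx a k) = k.
  rewrite /swap_idx; have [->|ka] := eqVneq k a; first by rewrite eqxx ifN //; lia.
  have [->|ka1] := eqVneq k a.+1; first by rewrite eqxx.
  by rewrite (negbTE ka) (negbTE ka1).
by rewrite /sign_flip E.
Qed.

Lemma flippable_cent_long :
  flippable (fun=> true) -> exists l : coxeter_group M, cent_long J l.
Proof.
move=> [x xJ H]; exists x; apply: cent_long_neg => // f j /JE [a an ->].
have [y fy] := ex_coords f; have [H1 H2] := H f y fy; case: fy => F1 F2.
have [E|NE] := eqVneq a n.-1; first by rewrite E H2 F2 last_formN.
have an1 : (a.+1 < n)%N by lia.
by rewrite H1 // F1 // /sign_flip; ring.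
Qed.

End SignChanges.

Section TypesBD.
Variables (I : finType) (M : coxeter_matrix I) (n : nat) (e : nat -> I) (J : {set I}).
Hypotheses (JE : forall x, x \in J <-> exists2 a, (a < n)%N & x = e a).
Local Open Scope R_scope.

(** Recovers coordinates from a form: at [j = n - 1 - a] it is [c + f (e a) + ... + f (e (n - 2))],
    coordinate [a] when the last one is [c]. *)
Fixpoint tail_sums (c : R) (f : I -> R) (j : nat) : R :=
  if j is j'.+1 then f (e (n.-1 - j)%N) + tail_sums c f j' else c.

Lemma tail_sumsE c f a : (a.+1 < n)%N ->
  f (e a) = tail_sums c f (n.-1 - a)%N - tail_sums c f (n.-1 - a.+1)%N.
Proof.
move=> an; have -> : (n.-1 - a = (n.-1 - a.+1).+1)%N by lia.
rewrite /=; have -> : (n.-1 - (n.-1 - a.+1).+1 = a)%N by lia.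
by ring.
Qed.

Lemma cent_long_B : (1 < n)%N ->
    (forall a b, (a < n)%N -> (b < n)%N -> M (e a) (e b) = type_label (TypeB n) a b) ->
  exists l : coxeter_group M, cent_long J l.
Proof.
move=> n1 ML; have n0 := ltnW n1.
set c := root_coef 4; have [cc c0] : c * c = 2 /\ 0 < c := root_coef4.
(* All simple roots are given the same length, so the last one is [sqrt 2] times a unit vector; this
   makes the coefficients symmetric. *)
pose lf (y : nat -> R) := c * y n.-1.
have coefE a b : (a < n)%N -> (b < n)%N -> root_coef (M (e a) (e b)) =
    if a == b then -2 else if (b == a.+1) || (a == b.+1) then
      if maxn a b == n.-1 then c else 1 else 0.
  move=> an bn; rewrite ML // /type_label /= /path_label.
  have [_|ab] := eqVneq a b; first exact: root_coef1.
  have -> : (maxn a b == (minn a b).+1) = (b == a.+1) || (a == b.+1) by lia.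
  case: ifP => Eab; last exact: root_coef2.
  rewrite nth_rcons size_nseq nth_nseq.
  have -> : (minn a b < n - 2)%N = (maxn a b != n.-1) by lia.
  have [En|_] /= := eqVneq (maxn a b) n.-1; last exact: root_coef3.
  by have -> : minn a b == (n - 2)%N by lia.
have sw a f y : (a.+1 < n)%N -> coords n e lf f y ->
    coords n e lf (rrefl M (e a) f) (fun k => y (swap_idx a k)).
  move=> an [H1 H2]; rewrite /coords /rrefl /lf /swap_idx; split=> [b bn|].
    rewrite coefE ?(ltnW an) ?(ltnW bn) // !H1 //.
    have [<-|ab] := eqVneq a b; first by rewrite !eqxx [_.+1 == _]gtn_eqF //; ring.
    rewrite eqSS [b == a]eq_sym (negbTE ab).
    have [Eb|ba] := eqVneq b a.+1.
      rewrite Eb in bn *; have -> : (a.+2 == a) = false by lia.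
      rewrite /=.
      have -> : (maxn a a.+1 == n.-1) = false by lia.
      by ring.
    have [Eb|ba'] /= := eqVneq a b.+1.
      rewrite Eb in an *; have -> : (maxn b.+1 b == n.-1) = false by lia.
      by rewrite ?eqxx; ring.
    by ring.
  rewrite H2 /lf coefE ?(ltnW an) //; last by lia.
  have -> : (a == n.-1) = false by lia.
  have -> : (a == n.-1.+1) = false by lia.
  have -> : (maxn a n.-1 == n.-1) by lia.
  rewrite orbF eq_sym; have -> : (n.-1 == a) = false by lia.
  rewrite eq_sym; have [En|NE] := eqVneq n.-1 a.+1; last by ring.
  by rewrite H1 // En; ring.
have ex f : exists y, coords n e lf f y.
  exists (fun k => tail_sums (f (e n.-1) / c) f (n.-1 - k)%N); split.
    by move=> a an; exact: tail_sumsE.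
  by rewrite /lf subnn /=; field; lra.
have flip_last : @flippable I M n e J lf (pred1 n.-1).
  exists (simple_refl M (e n.-1)).
    by apply: par_simple; apply/JE; exists n.-1; rewrite ?prednK.
  move=> f y [H1 H2]; rewrite gact_simple /rrefl /coords /lf /sign_flip /=; split.
    move=> a an; rewrite coefE ?(ltnW an) ?prednK // H1 // H2 /lf.
    have -> : (n.-1 == a) = false by lia.
    have -> : (a == n.-1) = false by lia.
    have -> : (a == n) = false by lia.
    have -> : (maxn n.-1 a == n.-1) by lia.
    rewrite /= [n.-1 == _]eq_sym; have [En|NE] := eqVneq a.+1 n.-1; last by ring.
    rewrite -En.
    have -> : y a - y a.+1 + c * (c * y a.+1) = y a - y a.+1 + c * c * y a.+1 by ring.
    by rewrite cc; ring.
  by rewrite coefE ?prednK // !eqxx H2 /lf; ring.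
have lfN y : lf (fun k => - y k) = - lf y by rewrite /lf; ring.
have lfE y y' : (forall k, (k < n)%N -> y k = y' k) -> lf y = lf y'.
  by move=> E; rewrite /lf E ?prednK.
have flip1 j : (j < n)%N -> @flippable I M n e J lf (pred1 (n.-1 - j)%N).
  elim: j => [|j IH] jn; first by rewrite subn0.
  have jn' := ltnW jn.
  have an : ((n.-1 - j.+1).+1 < n)%N by lia.
  have := flippable_swap n0 JE lfE sw an (IH jn').
  apply: flippable_ext => // k kn /=.
  by rewrite /swap_idx; do 2?[case: ifP => ?]; lia.
have flip_lt j : (j <= n)%N -> @flippable I M n e J lf (fun k => (k < j)%N).
  elim: j => [|j IH] jn; first exact: flippable0.
  have := flippable_add lfE (IH (ltnW jn)) (flip1 (n.-1 - j)%N ltac:(lia)).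
  by apply: flippable_ext => // k kn /=; case: ltngtP; lia.
apply: (flippable_cent_long n0 JE ex lfN).
by have := flip_lt n (leqnn n); apply: flippable_ext => // k ->.
Qed.

Lemma cent_long_D : (3 < n)%N -> ~~ odd n ->
    (forall a b, (a < n)%N -> (b < n)%N -> M (e a) (e b) = type_label (TypeD n) a b) ->
  exists l : coxeter_group M, cent_long J l.
Proof.
move=> n3 ev ML; have n0 : (0 < n)%N by lia.
pose lf (y : nat -> R) := y n.-2 + y n.-1.
have coefE a b : (a < n)%N -> (b < n)%N -> root_coef (M (e a) (e b)) =
    if a == b then -2 else
    if [|| (b == a.+1) && (b < n.-1)%N, (a == b.+1) && (a < n.-1)%N,
           (a == (n - 3)%N) && (b == n.-1) | (b == (n - 3)%N) && (a == n.-1)]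
    then 1 else 0.
  move=> an bn; rewrite ML // /type_label /= /branch_label.
  have [_|ab] := eqVneq a b; first exact: root_coef1.
  case: ifP => E1; case: ifP => E2; rewrite ?root_coef2 ?root_coef3 //; lia.
have sw a f y : (a.+1 < n)%N -> coords n e lf f y ->
    coords n e lf (rrefl M (e a) f) (fun k => y (swap_idx a k)).
  move=> an [H1 H2]; rewrite /coords /rrefl /lf /swap_idx; split=> [b bn|].
    rewrite coefE ?(ltnW an) ?(ltnW bn) // !H1 //.
    have [<-|ab] := eqVneq a b; first by rewrite !eqxx [_.+1 == _]gtn_eqF //; ring.
    rewrite eqSS [b == a]eq_sym (negbTE ab).
    have [Eb|ba] := eqVneq b a.+1.
      rewrite Eb in bn *; have -> : (a.+2 == a) = false by lia.
      rewrite /=.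
      have -> : (a.+1 < n.-1)%N by lia.
      by rewrite /=; ring.
    have [Eb|ba'] /= := eqVneq a b.+1.
      rewrite Eb in an *; have -> : (b.+1 < n.-1)%N by lia.
      by rewrite ?eqxx /=; ring.
    by case: ifP; [lia|move=> _; ring].
  rewrite H2 /lf coefE ?(ltnW an) //; last by lia.
  rewrite H1 //.
  have [Ea|Na] := eqVneq a n.-2.
    have -> : (n.-1 == a) = false by lia.
    have -> : (n.-1 == a.+1) by lia.
    case: ifP; first by lia.
    case: ifP; first by lia.
    rewrite eqxx Ea; have -> : n.-2.+1 = n.-1 by lia.
    move=> _ _; ring.
  have [Ea|Na'] := eqVneq a (n - 3)%N.
    have -> : (n.-2 == a.+1) by lia.
    have -> : (n.-1 == a) = false by lia.
    have -> : (n.-1 == a.+1) = false by lia.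
    case: ifP; first by lia.
    case: ifP; last by lia.
    have -> : a.+1 = n.-2 by lia.
    move=> _ _; ring.
  have -> : (n.-2 == a.+1) = false by lia.
  have -> : (n.-1 == a) = false by lia.
  have -> : (n.-1 == a.+1) = false by lia.
  case: ifP; first by lia.
  case: ifP; first by lia.
  move=> _ _; ring.
have ex f : exists y, coords n e lf f y.
  exists (fun k => tail_sums ((f (e n.-1) - f (e n.-2)) / 2) f (n.-1 - k)%N); split.
    by move=> a an; exact: tail_sumsE.
  rewrite /lf subnn; have -> : (n.-1 - n.-2 = 1)%N by lia.
  by rewrite /= subn1; field.
have lfN y : lf (fun k => - y k) = - lf y by rewrite /lf; ring.
have lfE y y' : (forall k, (k < n)%N -> y k = y' k) -> lf y = lf y'.
  by move=> E; rewrite /lf !E //; lia.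
(* The last two roots are the difference and the sum of the last two coordinates; the product of
   their reflections negates both. Signs thus come in pairs, and [n] must be even to reach -1. *)
have flip_last : @flippable I M n e J lf (fun k => (k == n.-2) || (k == n.-1)).
  have lastJ : parabolic M J (simple_refl M (e n.-1)).
    by apply: par_simple; apply/JE; exists n.-1 => //; lia.
  have prevJ : parabolic M J (simple_refl M (e n.-2)).
    by apply: par_simple; apply/JE; exists n.-2 => //; lia.
  exists (simple_refl M (e n.-1) * simple_refl M (e n.-2))%g; first exact: parM.
  move=> f y /(sw n.-2 f y ltac:(lia)) [H1 H2].
  rewrite gactM !gact_simple; move: (rrefl M (e n.-2) f) H1 H2 => g H1 H2.
  have E1 : swap_idx n.-2 n.-2 = n.-1 by rewrite /swap_idx eqxx; lia.
  have E2 : swap_idx n.-2 n.-1 = n.-2.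
    rewrite /swap_idx; have -> : (n.-1 == n.-2) = false by lia.
    by have -> : (n.-1 == n.-2.+1) by lia.
  have E3 k : (k < n.-2)%N -> swap_idx n.-2 k = k.
    by move=> kn; rewrite /swap_idx; case: eqP => ?; [lia|case: eqP => ?; lia].
  rewrite /rrefl /coords /sign_flip H2 /lf E1 E2; split.
    move=> a an; rewrite coefE ?H1 //; try lia.
    have [Ea|Na] := eqVneq a n.-2.
      have -> : a.+1 = n.-1 by lia.
      rewrite Ea E1 E2 eqxx.
      have -> : (n.-1 == n.-2) = false by lia.
      by case: ifP; [lia|move=> _ /=; ring].
    have [Ea'|Na'] := eqVneq a (n - 3)%N.
      have -> : a.+1 = n.-2 by lia.
      rewrite E1 E3; last by lia.
      have -> : (n.-1 == a) = false by lia.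
      have -> : (a == n.-1) = false by lia.
      rewrite !eqxx.
      by case: ifP; [move=> _ /=; ring|lia].
    rewrite !E3; try lia.
    have -> : (n.-1 == a) = false by lia.
    have -> : (a == n.-1) = false by lia.
    have -> : (a.+1 == n.-1) = false by lia.
    have -> : (a.+1 == n.-2) = false by lia.
    by case: ifP; [lia|move=> _ /=; ring].
  rewrite coefE ?eqxx ?orbT; try lia.
  by rewrite /=; ring.
have flip2 j : (j.+1 < n)%N ->
    @flippable I M n e J lf (fun k => (k == n.-2 - j)%N || (k == n.-1 - j)%N).
  elim: j => [|j IH] jn; first by rewrite !subn0.
  have jn' := ltnW jn.
  have an1 : ((n.-2 - j.+1).+1 < n)%N by lia.
  have an2 : ((n.-2 - j).+1 < n)%N by lia.
  (* With [m = n - 3 - j], the pair [m + 1, m + 2] becomes [m, m + 2] and then [m, m + 1]. *)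
  have := flippable_swap n0 JE lfE sw an2 (flippable_swap n0 JE lfE sw an1 (IH jn')).
  apply: flippable_ext => // k kn /=; rewrite /swap_idx.
  have E1 : (n.-1 - j.+1 = n.-2 - j)%N by lia.
  have E2 : (n.-2 - j = (n.-2 - j.+1).+1)%N by lia.
  have E3 : (n.-1 - j = (n.-2 - j.+1).+2)%N by lia.
  rewrite E1 E2 E3; move: (n.-2 - j.+1)%N => m.
  by case: (k =P m.+1) => ?; [|case: (k =P m.+2) => ?]; do ?[case: ifP => ?]; lia.
have flip_lt j : (j.*2 <= n)%N -> @flippable I M n e J lf (fun k => (k < j.*2)%N).
  elim: j => [|j IH] jn; first exact: flippable0.
  have jn' : (j.*2 <= n)%N by lia.
  have jn2 : ((n.-2 - j.*2).+1 < n)%N by lia.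
  have := flippable_add lfE (IH jn') (flip2 _ jn2).
  apply: flippable_ext => // k kn /=.
  have -> : (n.-2 - (n.-2 - j.*2) = j.*2)%N by lia.
  have -> : (n.-1 - (n.-2 - j.*2) = j.*2.+1)%N by lia.
  by rewrite doubleS; case: ltngtP; case: eqP; lia.
apply: (flippable_cent_long n0 JE ex lfN).
have nE : n = n./2.*2 by rewrite even_halfK.
have := flip_lt n./2; rewrite -nE => /(_ (leqnn n)).
by apply: flippable_ext => // k ->.
Qed.

End TypesBD.

(** * The listed types and reduction to connected components *)

Section OTypes.
Variables (I : finType) (M : coxeter_matrix I).
Implicit Types (J C : {set I}).

Lemma O_type_rank_gt0 t : O_type t -> 0 < type_rank t.
Proof.
by case: t => [n|n|n|n|||n|m] //=; try lia; move=> [k k2 ->]; lia.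
Qed.

Lemma has_type_index J t : has_type M [set` J] t -> 0 < type_rank t ->
  exists e : nat -> I,
    (forall x, x \in J <-> exists2 a, a < type_rank t & x = e a) /\
    (forall a b, a < type_rank t -> b < type_rank t ->
       M (e a) (e b) = type_label t a b).
Proof.
rewrite /has_type; case: (type_rank t) => // n [f [[fJ _ f_surj] Mf]] _.
exists (fun a => f (inord a)); split.
- move=> x; split=> [xJ|[a an ->]]; last exact: fJ.
  by have [a _ <-] := f_surj x xJ; exists a; rewrite // inord_val.
- by move=> a b an bn; rewrite Mf !inordK.
Qed.

Lemma type_label_I2 m a b : a < 2 -> b < 2 ->
  type_label (TypeI2 m) a b = if a == b then 1%N else m.
Proof. by case: a b => [|[|]] // [|[|]]. Qed.

Lemma cent_long_rank2 J (e : nat -> I) m :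
    (forall x, x \in J <-> exists2 a, a < 2 & x = e a) ->
    (forall a b, a < 2 -> b < 2 -> M (e a) (e b) = if a == b then 1%N else m) ->
    0 < m -> ~~ odd m ->
  exists l : coxeter_group M, cent_long J l.
Proof.
move=> JE ML m0 ev; have ij : e 0%N != e 1%N.
  apply/eqP => E; have := ML 0%N 1%N isT isT; rewrite E cox_diag /= => m1.
  by rewrite -m1 in ev.
have -> : J = [set e 0%N; e 1%N]%SET.
  apply/setP => x; rewrite !inE; apply/idP/orP.
    by move=> /JE [[|[|]] // _ ->]; rewrite eqxx; [left | right].
  by case=> /eqP ->; apply/JE; [exists 0%N | exists 1%N].
by apply: cent_long_dihedral; rewrite ?ML //= => m0'; rewrite m0' in m0.
Qed.

(* For the exceptional types the word is the Coxeter element to the power [h / 2],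
   [h] being the Coxeter number. *)
Lemma cent_long_has_type J t : has_type M [set` J] t -> O_type t ->
  exists l : coxeter_group M, cent_long J l.
Proof.
move=> + Ot => /has_type_index /(_ (O_type_rank_gt0 Ot)) [e [JE ML]].
case: t Ot JE ML => [n|n|n|n|||n|m] /=.
- move=> -> JE ML; exists (simple_refl M (e 0%N)).
  suff -> : J = [set e 0%N]%SET by exact: cent_long1.
  apply/setP => x; rewrite inE; apply/idP/eqP => [/JE [[|//] _ ->] //|->].
  by apply/JE; exists 0%N.
- by move=> n2 JE ML; exact: cent_long_B ML.
- by move=> [k k2 ->] JE ML; apply: cent_long_D ML => //; [lia | rewrite odd_double].
(* The computation takes place in some quadratic ring; for the simply laced types E it is the golden
   one of label 5, as for type H. *)
- have h5 : (root_coef 5 * root_coef 5 = IZR 1 * root_coef 5 + IZR 1)%Re.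
    by rewrite root_coef5; ring.
  case=> -> JE ML.
    apply: (cent_long_word_rows h5 ML erefl _ _ (w := flatten (nseq 9 (iota 0 7)))) => //;
    by vm_compute.
  apply: (cent_long_word_rows h5 ML erefl _ _ (w := flatten (nseq 15 (iota 0 8)))) => //;
  by vm_compute.
- move=> _ JE ML.
  have h4 : (root_coef 4 * root_coef 4 = IZR 0 * root_coef 4 + IZR 2)%Re.
    by rewrite (root_coef4).1; ring.
  apply: (cent_long_word_rows h4 ML erefl _ _ (w := flatten (nseq 6 (iota 0 4)))) => //;
  by vm_compute.
- move=> _ JE ML; apply: (cent_long_rank2 (m := 6) JE) => // a b a2 b2.
  by rewrite ML //; case: a a2 => [|[|]] //; case: b b2 => [|[|]].
- have h5 : (root_coef 5 * root_coef 5 = IZR 1 * root_coef 5 + IZR 1)%Re.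
    by rewrite root_coef5; ring.
  case=> -> JE ML.
    apply: (cent_long_word_rows h5 ML erefl _ _ (w := flatten (nseq 5 (iota 0 3)))) => //;
    by vm_compute.
  apply: (cent_long_word_rows h5 ML erefl _ _ (w := flatten (nseq 15 (iota 0 4)))) => //;
  by vm_compute.
- move=> [k k2 ->] JE ML; apply: (cent_long_rank2 (m := k.*2) JE) => //.
  + by move=> a b a2 b2; rewrite ML // type_label_I2.
  + by rewrite double_gt0; apply: ltnW.
  + by rewrite odd_double.
Qed.

Definition component J i : {set I} :=
  [set j | `[< clos_refl_trans I (edge (diagram M J)) i j >]]%SET.

Lemma mem_component J i j :
  j \in component J i <-> clos_refl_trans I (edge (diagram M J)) i j.
Proof. by rewrite inE; split=> /asboolP. Qed.

Lemma component_sub J i : i \in J -> component J i \subset J.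
Proof.
move=> iJ; apply/fintype.subsetP => j; rewrite inE => /asboolP h.
by elim: h iJ => [x y [_ yJ _]|x|x y z _ IH1 _ IH2 xJ] //; apply: IH2; exact: IH1.
Qed.

Lemma component_self J i : i \in component J i.
Proof. by rewrite inE; apply/asboolP; exact: rt_refl. Qed.

Lemma component_closed J i j k : i \in J -> j \in component J i -> k \in J -> k \notin component J i ->
  j != k /\ M j k = 2.
Proof.
move=> iJ jC kJ kC; have jk : j != k by apply: contraNneq kC => <-.
split=> //; apply: contrapT => Mjk; case/negP: kC; move: (jC); rewrite !inE.
move=> h; apply: (rt_trans _ _ _ _ _ h); apply: rt_step.
split=> //=; first exact: (fintype.subsetP (component_sub iJ)).
by split=> //; exact/eqP.
Qed.

(** A path starting outside a component never enters it, so components can be split off one at a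
    time. *)
Lemma component_setD J i k : i \in J -> k \in J :\: component J i ->
  component (J :\: component J i) k = component J k.
Proof.
move=> iJ kD; have kD' := kD; move: kD'; rewrite inE => /andP [kC kJ].
apply/setP => j; rewrite !inE; apply/asboolP/asboolP.
  elim=> [x y [+ + xy]|x|x y z _ IH1 _ IH2]; last exact: (rt_trans _ _ _ _ _ IH1 IH2).
    rewrite /= !inE => /andP [_ xJ] /andP [_ yJ].
    by apply: rt_step.
  exact: rt_refl.
move=> h; suff: j \in J :\: component J i /\
    clos_refl_trans I (edge (diagram M (J :\: component J i)%SET)) k j by case.
move/clos_rt_rtn1_iff: h; elim=> [|x y [xJ yJ xy] _ [xD IH]].
  by split=> //; exact: rt_refl.
have yD : y \in J :\: component J i.
  rewrite inE [y \in J]yJ andbT; apply/negP => yC.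
  move: xD; rewrite inE => /andP [xC _].
  have [_ Myx] := component_closed iJ yC xJ xC.
  by case: xy => _; rewrite cox_sym.
by split=> //; apply: (rt_trans _ _ _ _ _ IH); apply: rt_step.
Qed.

Lemma cent_long_components J :
    (forall i, i \in J -> exists l : coxeter_group M, cent_long (component J i) l) ->
  exists l : coxeter_group M, cent_long J l.
Proof.
have [n] := ubnP #|J|; elim: n J => // n IH J ltJ H.
have [->|/set0Pn [i iJ]] := eqVneq J finset.set0; first by exists 1; exact: cent_long0.
set C := component J i; have sC : C \subset J := component_sub iJ.
have [l Cl] := H i iJ.
have [||l' Dl] := IH (J :\: C)%SET.
- rewrite -ltnS; apply: leq_trans ltJ; rewrite ltnS; apply: proper_card.
  apply/properP; split; first exact: finset.subsetDl.
  by exists i => //; rewrite inE component_self.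
- move=> k kD; rewrite component_setD //; apply: H.
  by move: kD; rewrite inE => /andP [].
exists (l * l'); have <- : (C :|: (J :\: C) = J)%SET.
  by rewrite -{1}(finset.setIidPr sC) finset.setID.
apply: cent_long_prod Cl Dl => j k jC; rewrite inE => /andP [kC kJ].
exact: component_closed jC kJ kC.
Qed.

Lemma cent_long_Omega J :
    (forall C : set I, pi0 (diagram M J) C -> exists t, O_type t /\ has_type M C t) ->
  exists l : coxeter_group M, cent_long J l.
Proof.
move=> H; apply: cent_long_components => i iJ.
have [|t [Ot tC]] := H [set` component J i].
  exists i => //; apply/seteqP.
  by split=> j /mem_component; apply.
exact: cent_long_has_type tC Ot.
Qed.

End OTypes.

(** * Infinite rank three subsystems *)

Section InfiniteTriples.
Variables (I : finType) (M : coxeter_matrix I).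
Local Notation W := (coxeter_group M).
Local Notation s := (simple_refl M).
Implicit Types (a b c : I) (x y : W) (J : {set I}).

Lemma inv_simple_neq a b : a != b -> inv (s a) (s b) = false.
Proof. by move=> ab; rewrite inv_simple (inj_eq (@simple_inj _ M)) eq_sym (negbTE ab). Qed.

Lemma simple_conj_neq a b : a != b -> M a b <> 2 -> (s b * s a * s b == s a) = false.
Proof.
move=> ab Mab; apply/negP => /eqP E; apply: Mab; apply: simple_commute => //.
by rewrite /commute -{1}E mulsK.
Qed.

Lemma inv_dihedral2 a b : a != b -> M a b <> 2 -> inv (s a * s b) (s a) = false.
Proof.
move=> ab Mab; have ba : b != a by rewrite eq_sym.
by rewrite invM inv_simple_neq // simpleV inv_simple simple_conj_neq.
Qed.

Lemma inv_dihedral3 a b : a != b -> M a b <> 2 -> M a b <> 3 ->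
  inv (s a * s b * s a) (s b) = false.
Proof.
move=> ab Mab Mab3; rewrite invM inv_simple_neq // simpleV invM !inv_simple.
have Mba : M b a <> 2 by rewrite cox_sym.
rewrite simple_conj_neq ?(eq_sym b) // simpleV /=.
apply/negP => /eqP E.
have E3 : (s a * s b) ^+ 3 = 1.
  have -> : (s a * s b) ^+ 3 = s a * (s b * (s a * s b * s a) * s b).
    by rewrite !expgSr mul1g !mulgA.
  by rewrite E simpleK.
have := @cox_off_diag _ M _ _ ab; case Em: (M a b) => [|[|[|[|m]]]] //.
  by move=> _; apply: (simple_order ab _ _ E3) => //; left.
by move=> _; apply: (simple_order ab _ _ E3) => //; right; rewrite Em.
Qed.

Lemma minr2 a b x : inv x (s a) = false -> inv x (s b) = false ->
  minr [set a; b]%SET x.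
Proof. by move=> xa xb; apply: minrP => j; rewrite !inE => /orP [] /eqP ->. Qed.

(** Localisation to rank two: after a common ascent the descents are those of the dihedral factor.
    This controls the growing words below. *)
Lemma inv_mul_minr2 a b x y : inv x (s a) = false -> inv x (s b) = false ->
  parabolic M [set a; b]%SET y -> inv (x * y) (s a) = inv y (s a).
Proof.
move=> xa xb yab; apply: minr_inv_mul (minr2 xa xb) yab _.
by rewrite !inE eqxx.
Qed.

Lemma par2l a b : parabolic M [set a; b]%SET (s a).
Proof. by apply: par_simple; rewrite !inE eqxx. Qed.

Lemma par2r a b : parabolic M [set a; b]%SET (s b).
Proof. by apply: par_simple; rewrite !inE eqxx orbT. Qed.

Lemma inv_mul_asc a b x : a != b -> inv x (s a) = false -> inv x (s b) = false ->
  inv (x * s b) (s a) = false.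
Proof.
move=> ab xa xb; rewrite (inv_mul_minr2 xa xb (@par2r a b)) inv_simple_neq //.
by rewrite eq_sym.
Qed.

(* The reduced words [a b c a b c ...]. *)
Lemma unbounded_cycle J a b c n : a \in J -> b \in J -> c \in J ->
    a != b -> b != c -> c != a -> M a b <> 2 -> M b c <> 2 -> M c a <> 2 ->
  exists x, [/\ parabolic M J x, n <= len x
    & [\/ [/\ inv x (s a), inv x (s b) = false, inv x (s c) = false
            & inv (x * s a) (s b) = false],
          [/\ inv x (s b), inv x (s c) = false, inv x (s a) = false
            & inv (x * s b) (s c) = false]
        | [/\ inv x (s c), inv x (s a) = false, inv x (s b) = false
            & inv (x * s c) (s a) = false]]].
Proof.
move=> aJ bJ cJ ab bc ca Mab Mbc Mca.
have step d e f x : d != e -> e != f -> f != d -> M d e <> 2 ->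
    [/\ inv x (s d), inv x (s e) = false, inv x (s f) = false
      & inv (x * s d) (s e) = false] ->
    [/\ inv (x * s e) (s e), inv (x * s e) (s f) = false, inv (x * s e) (s d) = false
      & inv (x * s e * s e) (s f) = false].
  move=> de ef fd Mde [xd xe xf xde]; rewrite mulsK; split=> //.
  - by rewrite inv_mul_simple xe.
  - by apply: inv_mul_asc; rewrite // eq_sym.
  - have -> : x * s e = x * s d * (s d * s e) by rewrite mulgA mulsK.
    rewrite (inv_mul_minr2 _ xde) ?inv_dihedral2 ?inv_mul_simple ?xd //.
    exact: parM (@par2l d e) (@par2r d e).
elim: n => [|n [x [xJ nx H]]].
  exists (s a); split=> //; first exact: par_simple.
  apply: Or31; split; [by rewrite inv_simple eqxx|exact: inv_simple_neq| |].
    by rewrite inv_simple_neq // eq_sym.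
  by rewrite simpleK inv1.
case: H => [H|H|H].
- exists (x * s b); split; [exact: parM xJ (par_simple bJ)| |by apply: Or32; exact: step H].
  by case: H => _ xb _ _; rewrite len_asc.
- exists (x * s c); split; [exact: parM xJ (par_simple cJ)| |by apply: Or33; exact: step H].
  by case: H => _ xb _ _; rewrite len_asc.
- exists (x * s a); split; [exact: parM xJ (par_simple aJ)| |by apply: Or31; exact: step H].
  by case: H => _ xb _ _; rewrite len_asc.
Qed.

(* The reduced words [a c (b c a) (b c a) ...]. *)
Lemma unbounded_path J a b c n : a \in J -> b \in J -> c \in J ->
    a != b -> b != c -> a != c -> M a b <> 2 -> M a b <> 3 -> M b c <> 2 ->
    M b c <> 3 -> M a c = 2 ->
  exists x, [/\ parabolic M J x, n <= len x, inv x (s b) = false,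
    inv x (s a) /\ inv x (s c)
    & inv (x * s a) (s b) = false /\ inv (x * s c) (s b) = false].
Proof.
move=> aJ bJ cJ ab bc ac Mab2 Mab3 Mbc2 Mbc3 /commute_simple Cac.
have [ba [cb ca]] : b != a /\ c != b /\ c != a by rewrite !(eq_sym _ a) (eq_sym c).
have [Mcb2 Mcb3] : M c b <> 2 /\ M c b <> 3 by rewrite cox_sym.
elim: n => [|n [x [xJ nx xb [xa xc] [xab xcb]]]].
  exists (s a * s c); split=> //; first exact: parM (par_simple aJ) (par_simple cJ).
  - apply/negP => /(inv_par (parM (@par2l a c) (@par2r a c))) /par_simple_mem.
    by rewrite !inE (negbTE ba) (negbTE bc).
  - split; last by rewrite inv_mul_simple inv_simple_neq.
    by rewrite Cac inv_mul_simple inv_simple_neq.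
  - by rewrite mulsK Cac mulsK !inv_simple_neq.
have yE d e : inv x (s d) -> inv (x * s d) (s e) = false -> d != e -> M d e <> 2 ->
    inv (x * s e) (s d) = false.
  move=> xd xde de Mde; have -> : x * s e = x * s d * (s d * s e) by rewrite mulgA mulsK.
  rewrite (inv_mul_minr2 _ xde) ?inv_dihedral2 ?inv_mul_simple ?xd //.
  exact: parM (@par2l d e) (@par2r d e).
have x1a := yE _ _ xa xab ab Mab2; have x1c := yE _ _ xc xcb cb Mcb2.
have zE d : inv x (s d) -> inv (x * s d) (s b) = false -> d != b -> M d b <> 2 ->
    M d b <> 3 -> inv (x * s b * s d) (s b) = false.
  move=> xd xdb db Mdb2 Mdb3.
  have -> : x * s b * s d = x * s d * (s d * s b * s d) by rewrite !mulgA mulsK.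
  have xdd : inv (x * s d) (s d) = false by rewrite inv_mul_simple xd.
  rewrite (inv_mul_minr2 xdb xdd) ?inv_dihedral3 //.
  exact: parM (parM (@par2r b d) (@par2l b d)) (@par2r b d).
have x2b := zE _ xc xcb cb Mcb2 Mcb3; have x2b' := zE _ xa xab ab Mab2 Mab3.
have x2a : inv (x * s b * s c) (s a) = false by apply: inv_mul_asc.
have x2c : inv (x * s b * s a) (s c) = false by apply: inv_mul_asc.
have E : x * s b * s c * s a = x * s b * s a * s c.
  by rewrite -!mulgA -Cac.
exists (x * s b * s c * s a); split.
- exact: parM (parM (parM xJ (par_simple bJ)) (par_simple cJ)) (par_simple aJ).
- by rewrite (len_asc x2a) (len_asc x1c) (len_asc xb) ltnS ltnW // ltnW.
- by apply: inv_mul_asc.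
- by split; [|rewrite E]; rewrite inv_mul_simple ?x2a ?x2c.
- by rewrite mulsK E mulsK.
Qed.

(** A triangle of noncommuting pairs, or a path whose two labels are at least 4 or infinite. When
    all labels are even, any two labels other than 2 at a common vertex fall under one of the
    cases. *)
Definition bad_triple J a b c :=
  [/\ a \in J, b \in J & c \in J] /\ [/\ a != b, b != c & c != a] /\
  ([/\ M a b <> 2, M b c <> 2 & M c a <> 2] \/
   [/\ M a b <> 2 /\ M a b <> 3, M b c <> 2 /\ M b c <> 3 & M a c = 2]).

Lemma unbounded_bad_triple J a b c n : bad_triple J a b c ->
  exists2 x, parabolic M J x & n <= len x.
Proof.
move=> [[aJ bJ cJ] [[ab bc ca] [[h1 h2 h3]|[[h1 h2] [h3 h4] h5]]]].
  by have [x [xJ nx _]] := unbounded_cycle n aJ bJ cJ ab bc ca h1 h2 h3; exists x.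
have ac : a != c by rewrite eq_sym.
by have [x [xJ nx _ _ _]] := unbounded_path n aJ bJ cJ ab bc ac h1 h2 h3 h4 h5; exists x.
Qed.

Lemma bad_triple_not_long J a b c l : bad_triple J a b c -> ~ @long _ M J l.
Proof.
move=> /(unbounded_bad_triple (len l).+1) [x xJ lx] L.
by have := long_le L xJ; rewrite leqNgt lx.
Qed.

Lemma bad_triple_infinite a b c : bad_triple [set: I]%SET a b c ->
  infinite_set [set: W].
Proof.
move=> bad fin; have fin' : finite_set (parabolic M [set: I]%SET).
  exact: sub_finite_set fin.
have [n le_n] := finite_par_bound fin'.
have [x xT] := unbounded_bad_triple n.+1 bad.
by rewrite ltnNge le_n.
Qed.

Lemma zero_label_infinite J a b : a \in J -> b \in J -> a != b -> M a b = 0 ->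
  infinite_set (parabolic M J).
Proof.
move=> aJ bJ ab Mab fin; pose f (k : nat) := (s a * s b) ^+ k.
have fJ k : parabolic M J (f k).
  elim: k => [|k IH]; first exact: par1.
  by rewrite /f expgSr; exact: parM IH (parM (par_simple aJ) (par_simple bJ)).
have f_inj i j : i <= j -> f i = f j -> i = j.
  move=> ij; rewrite /f -(subnKC ij) expgnDr -{1}[_ ^+ i]mulg1 => /mulgI E.
  case: (posnP (j - i)) => [->|k0]; first by rewrite addn0.
  by case: (simple_order ab k0 _ (esym E)); left.
apply: infinite_nat; apply: sub_finite_set (finite_preimage _ fin) => [k _|].
  exact: (fJ k).
move=> i j _ _ E; case: (leqP i j) => ij; first exact: f_inj.
by apply/esym/f_inj => //; exact: ltnW.
Qed.

End InfiniteTriples.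

(** * Counting classes *)

Section CardSet.
Implicit Types (T U S : choiceType).

(** As [card_set] is 0 on infinite sets, finiteness of [A] is delivered together with the bound. The
    matching is a relation because its witnesses are merely known to exist. *)
Lemma card_set_le T U (A : set T) (B : set U) (r : T -> U -> Prop) :
    finite_set B ->
    (forall a, A a -> exists2 b, B b & r a b) ->
    (forall a a' b, A a -> A a' -> r a b -> r a' b -> a = a') ->
  finite_set A /\ card_set A <= card_set B.
Proof.
move=> finB rAB r_inj.
have [[a0 Aa0]|A0] := pselect (exists a, A a); last first.
  have -> : A = set0 by apply/seteqP; split=> // a Aa; case: A0; exists a.
  by rewrite /card_set fset_set0 cardfs0.
have [b0 _ _] := rAB _ Aa0.
have /choice [f Hf] : forall a, exists b, A a -> B b /\ r a b.
  move=> a; have [Aa|NA] := pselect (A a); last by exists b0.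
  by have [b Bb rb] := rAB a Aa; exists b.
have f_inj : {in A &, injective f}.
  move=> a a'; rewrite !inE => Aa Aa' E; have [_ ra] := Hf a Aa.
  by have [_ ra'] := Hf a' Aa'; apply: r_inj Aa Aa' ra _; rewrite E.
have finA : finite_set A.
  rewrite -(eq_finite_set (inj_card_eq f_inj)); apply: sub_finite_set finB.
  by move=> _ [a Aa <-]; case: (Hf a Aa).
split=> //; rewrite /card_set.
have inA a : a \in fset_set A -> A a by rewrite in_fset_set // inE.
have <- : #|` [fset f a | a in fset_set A]%fset| = #|` fset_set A|.
  apply: card_in_imfset => a a' /inA Aa /inA Aa'; apply: f_inj; rewrite inE; assumption.
apply: fsubset_leq_card; apply/fsubsetP => _ /imfsetP [a /= /inA Aa ->].
by rewrite in_fset_set // inE; case: (Hf a Aa).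
Qed.

Lemma card_set_finset (F : finType) (Z : {set F}) : card_set [set` Z] = #|Z|.
Proof.
have -> : [set` Z] = [set` [fset x in Z]%fset] by apply/seteqP; split=> x; rewrite /= !inE.
by rewrite /card_set set_fsetK card_finset.
Qed.

Lemma card_set_bigcup T U S (A : set T) (q : seq S) (B : S -> set U)
    (r : T -> U -> Prop) :
    (forall h, h \in q -> finite_set (B h)) ->
    (forall a, A a -> exists2 h, h \in q & exists2 b, B h b & r a b) ->
    (forall a a' b, A a -> A a' -> r a b -> r a' b -> a = a') ->
  card_set A <= \sum_(h <- q) card_set (B h).
Proof.
move=> finB rAB r_inj.
have [finU leU] : finite_set (\big[setU/set0]_(h <- q) B h) /\
    card_set (\big[setU/set0]_(h <- q) B h) <= \sum_(h <- q) card_set (B h).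
  elim: q finB {rAB} => [|h q IH] finB.
    by rewrite !big_nil /card_set fset_set0 cardfs0.
  have [|fq lq] := IH; first by move=> g gq; apply: finB; rewrite inE gq orbT.
  have fh : finite_set (B h) by apply: finB; rewrite mem_head.
  rewrite !big_cons; split; first by rewrite finite_setU.
  rewrite /card_set fset_setU //; apply: leq_trans (leq_add (leqnn _) lq).
  by rewrite cardfsU leq_subr.
apply: leq_trans leU; apply: (card_set_le finU _ r_inj).2 => a Aa.
have [h hq [b Bb rb]] := rAB a Aa; exists b => //.
by rewrite -bigcup_seq; exists h.
Qed.

End CardSet.

(** * Homomorphisms to Z/2 and transversals of the classes *)

Section SignCharacters.
Variables (I : finType) (M : coxeter_matrix I).
Local Notation s := (simple_refl M).

(* [chi] extends to a homomorphism from the Coxeter group to Z/2. *)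
Lemma sign_character (chi : I -> bool) i j g :
    (forall a b, odd (M a b) -> chi a = chi b) -> g * s i = s j * g -> chi i = chi j.
Proof.
move=> chiM E; pose act (a : I) (b : bool) := b (+) chi a.
have rel a b : M a b <> 0 -> forall z, iter (M a b) (fun z => act a (act b z)) z = z.
  move=> _ z; have iterE n : iter n (fun z => act a (act b z)) z =
      z (+) (odd n && (chi a (+) chi b)).
    elim: n => [|n IH] /=; first by rewrite addbF.
    by rewrite IH /act; case: (odd n); case: (chi a); case: (chi b); case: (z).
  rewrite iterE; case odd_m: (odd _); last by rewrite addbF.
  by rewrite (chiM _ _ odd_m) addbb addbF.
have actE (x : coxeter_group M) z : cact act x z = z (+) cact act x false.
  have [w ->] := prods_surj x; elim: w z => [|a w IH] z /=.
    by rewrite !(cact1 rel) addbF.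
  by rewrite !(cactM rel) !(cact_simple rel) IH /act addbA.
have := congr1 (fun x : coxeter_group M => cact act x false) E.
rewrite !(cactM rel) !(cact_simple rel) [cact act g _]actE /act addFb.
by case: (chi i); case: (chi j); case: (cact _ _ _).
Qed.

End SignCharacters.

Section Classes.
Variables (I : finType) (M : coxeter_matrix I).
Local Notation W := (coxeter_group M).
Local Notation s := (simple_refl M).
Implicit Types (J K : {set I}) (x y l : W).

Definition conj_class x : set W := [set x ^ g | g in [set: W]].

Lemma conj_class_self x : conj_class x x.
Proof. by exists 1; rewrite ?conjg1. Qed.

Lemma conj_class_eq x y g : g * x = y * g -> conj_class x = conj_class y.
Proof.
move=> E; have Ex : x = y ^ g by rewrite conjgE -E mulKg.
have Ey : y = x ^ g^-1 by rewrite Ex -conjgM mulgV conjg1.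
apply/seteqP; split=> _ [h _ <-].
  by exists (g * h); rewrite // Ex conjgM.
by exists (g^-1 * h); rewrite // Ey conjgM.
Qed.

Lemma conj_class_conj x y : conj_class x y -> exists g, g * y = x * g.
Proof. by move=> [g _ <-]; exists g; rewrite conjgE mulVKg. Qed.

Lemma conj_class_mem x y : conj_class x y -> conj_class x = conj_class y.
Proof. by move=> /conj_class_conj [g /conj_class_eq]. Qed.

Lemma eq_conj_class x y : conj_class x = conj_class y -> exists g, g * x = y * g.
Proof. by move=> E; apply: conj_class_conj; rewrite -E; exact: conj_class_self. Qed.

Local Notation classes := (involution_classes [set: W]).

Lemma class_long c : classes c ->
  exists J l, [/\ J != finset.set0, cent_long J l & c = conj_class l].
Proof.
move=> [x [_ [x1 x2]] <-]; rewrite expg2 in x2.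
have [g [J [J0 C]]] := richardson x1 x2; exists J, (x ^ g); split=> //.
by apply: (@conj_class_eq _ _ g^-1); rewrite conjgE -mulgA mulgK.
Qed.

Lemma long_class J l : J != finset.set0 -> cent_long J l -> classes (conj_class l).
Proof.
move=> J0 C; exists l => //; split=> //; split; first exact: cent_long_neq1 C.
by rewrite expg2; exact: long_sq C.1.
Qed.

(** One index set for each class of involutions, so that class counts become cardinalities of
    families of subsets. *)
Definition transversal_spec (Z : {set {set I}}) :=
  [/\ forall J, J \in Z -> J != finset.set0 /\ exists l, @cent_long I M J l,
      forall J K l l' g, J \in Z -> K \in Z -> cent_long J l -> cent_long K l' ->
        g * l = l' * g -> J = K
    & forall J l, J != finset.set0 -> cent_long J l ->
        exists K l', [/\ K \in Z, cent_long K l' & conj_class l' = conj_class l]].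

(** A choice of [J] for each class is injective because the longest element of [J] is unique; this
    also bounds the number of classes. *)
Lemma classes_finite_transversal :
  finite_set classes /\ exists2 Z, transversal_spec Z & cc2 [set: W] = #|Z|.
Proof.
have /choice [f Hf] : forall c, exists J, classes c -> J != finset.set0 /\
    exists2 l, @cent_long I M J l & c = conj_class l.
  move=> c; have [cc|nc] := pselect (classes c); last by exists finset.set0.
  by have [J [l [J0 C E]]] := class_long cc; exists J => _; split=> //; exists l.
pose Z := [set J | `[< exists2 c, classes c & f c = J >]]%SET.
have inZ J : J \in Z <-> exists2 c, classes c & f c = J.
  by rewrite inE; split=> /asboolP.
have f_inj c c' : classes c -> classes c' -> f c = f c' -> c = c'.
  move=> cc cc' E; have [_ [l C ->]] := Hf c cc; have [_ [l' C' ->]] := Hf c' cc'.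
  by move: C'; rewrite -E => C'; rewrite (long_uniq C.1 C'.1).
have [fin le1] : finite_set classes /\ card_set classes <= card_set [set` Z].
  apply: (@card_set_le _ _ _ _ (fun c J => f c = J)) => [|c cc|c c' J cc cc' <- E].
  - exact: finite_finset.
  - by exists (f c) => //=; apply/inZ; exists c.
  - exact/f_inj/esym.
have [_ le2] : finite_set [set` Z] /\ card_set [set` Z] <= card_set classes.
  apply: (@card_set_le _ _ _ _ (fun J c => classes c /\ f c = J)) => //.
    by move=> J /= /inZ [c cc E]; exists c.
  by move=> J K c _ _ [_ <-] [_ <-].
split=> //; exists Z; last first.
  by apply/eqP; rewrite eqn_leq -(card_set_finset Z) le1 le2.
split.
- by move=> J /inZ [c cc <-]; have [J0 [l C _]] := Hf c cc; split=> //; exists l.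
- move=> J K l l' g /inZ [c cc <-] /inZ [c' cc' <-] C C' /conj_class_eq E.
  have [_ [l1 C1 E1]] := Hf c cc; have [_ [l1' C1' E1']] := Hf c' cc'.
  by congr f; rewrite E1 E1' -(long_uniq C.1 C1.1) -(long_uniq C'.1 C1'.1).
- move=> J l J0 C; have cl := long_class J0 C; have [_ [l' C' E]] := Hf _ cl.
  by exists (f (conj_class l)), l'; split=> //; apply/inZ; exists (conj_class l).
Qed.

Lemma card_nonempty_sets : #|[set~ finset.set0 : {set I}]%SET| = 2 ^ #|I| - 1.
Proof. by rewrite cardsC1 -cardsT -powersetT card_powerset cardsT subn1. Qed.

Lemma card_proper_sets : 0 < #|I| ->
  #|~: [set finset.set0; [set: I]]%SET| = 2 ^ #|I| - 2.
Proof.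
move=> I0; rewrite cardsCs finset.setCK cards2 eq_sym -card_gt0 cardsT I0.
by rewrite -[#|{set I}|]cardsT -powersetT card_powerset cardsT.
Qed.

Lemma cc2_ge (Y : {set {set I}}) :
    (forall J, J \in Y -> J != finset.set0 /\ exists l, @cent_long I M J l) ->
    (forall J K l l' g, J \in Y -> K \in Y -> cent_long J l -> cent_long K l' ->
       g * l = l' * g -> J = K) ->
  #|Y| <= cc2 [set: W].
Proof.
move=> HY Yinj; have [fin _] := classes_finite_transversal.
rewrite -card_set_finset.
apply: (@card_set_le _ _ _ _
  (fun J c => exists2 l, @cent_long I M J l & c = conj_class l) fin _ _).2.
  move=> J /= /HY [J0 [l C]]; exists (conj_class l); first exact: long_class C.
  by exists l.
move=> J K _ /= JY KY [l C ->] [l' C' /eq_conj_class [g E]].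
exact: Yinj JY KY C C' E.
Qed.

(** With even or infinite labels the indicator of a single generator is a sign character, so
    distinct simple reflections are not conjugate and the element from [conj_cent_long] matches [J]
    with [K] identically. *)
Lemma even_labels_conj J K l l' g : (forall i j, i != j -> ~~ odd (M i j)) ->
  cent_long J l -> cent_long K l' -> g * l = l' * g -> J = K.
Proof.
move=> ev C C' /(conj_cent_long C C') [h [hJ hK]].
have simple_conj i j r : r * s i = s j * r -> i = j.
  move=> E; apply/eqP; rewrite eq_sym -[_ == _]/(pred1 i j).
  rewrite -(@sign_character _ M (pred1 i) i j r _ E) /= ?eqxx // => a b odd_m.
  by have [-> //|ab] := eqVneq a b; have := ev _ _ ab; rewrite odd_m.
apply/eqP; rewrite finset.eqEsubset; apply/andP; split; apply/fintype.subsetP => j jJ.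
  have [k kK E] := hJ j jJ; rewrite (simple_conj j k h) //.
  by rewrite -E mulgVK.
have [k kJ E] := hK j jJ; rewrite (simple_conj j k h^-1) //.
by rewrite -E mulgK.
Qed.

End Classes.

(** * The two chains of inequalities and the extremal case *)

Section Bounds.
Variables (I : finType) (M : coxeter_matrix I).
Local Notation W := (coxeter_group M).
Local Notation s := (simple_refl M).
Local Notation classes := (involution_classes [set: W]).
Implicit Types (J K : {set I}).

Lemma connected_eq T (E : graph T) x y :
    clos_refl_trans T (edge E) x y -> clos_refl_trans T (edge E) y x ->
  [set z | clos_refl_trans T (edge E) x z] = [set z | clos_refl_trans T (edge E) y z].
Proof.
by move=> xy yx; apply/seteqP; split=> z h; [exact: rt_trans yx h|exact: rt_trans xy h].
Qed.

(** The indicator of a component of the odd graph is constant along odd labels, hence a sign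
    character, hence a conjugacy invariant. *)
Lemma conj_simple_connected i j g : g * s i = s j * g ->
  clos_refl_trans W (edge (Omega1 M)) (s i) (s j).
Proof.
pose chi a := `[< clos_refl_trans W (edge (Omega1 M)) (s i) (s a) >].
have step a b : odd (M a b) -> chi a -> chi b.
  move=> odd_m /asboolP h; apply/asboolP.
  have [<- //|ab] := eqVneq a b; apply: rt_trans h _; apply: rt_step.
  split; [by exists a | by exists b | exists a, b; split=> //].
  by have := @cox_off_diag _ M _ _ ab; case: (M a b) odd_m => [|[|[|]]].
move=> /(@sign_character _ M chi) E; apply/asboolP; rewrite -/(chi j) -E.
  by apply/asboolP; exact: rt_refl.
move=> a b odd_m; apply/idP/idP; apply: step => //.
by rewrite cox_sym.
Qed.

(** A component is sent to the chosen representative of the class of the central longest element of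
    one of its vertices. That subset determines the class, and conjugate vertices are connected. *)
Lemma O_components_le Z k : transversal_spec M Z -> 0 < k ->
  O_components M k <= #|[set J in Z | #|J| == k]%SET|.
Proof.
move=> [_ _ Zrep] k0; rewrite /O_components.
have finZ : finite_set [set` [set J in Z | #|J| == k]%SET] by exact: finite_finpred.
rewrite -card_set_finset; case: eqP => [k1|_].
  apply: (@card_set_le _ _ _ _ (fun p J => exists i l,
    [/\ p = [set z | clos_refl_trans W (edge (Omega1 M)) (s i) z],
        cent_long J l & conj_class l = conj_class (s i)]) finZ _ _).2.
    move=> _ [_ [i _ <-] <-].
    have i0 : [set i]%SET != finset.set0 by apply/set0Pn; exists i; rewrite inE.
    have [K [l [KZ C E]]] := Zrep _ _ i0 (cent_long1 M i).
    exists K; last by exists i, l.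
    have [g Eg] := eq_conj_class E.
    by rewrite /= inE KZ (conj_cent_long_card C (cent_long1 M i) Eg) cards1 k1 /=.
  move=> _ _ J _ _ [i [l [-> C E]]] [j [l' [-> C' E']]].
  have El := long_uniq C.1 C'.1; rewrite El in E.
  have /eq_conj_class [g Eg] : conj_class (s i) = conj_class (s j) by rewrite -E -E'.
  have /eq_conj_class [g' Eg'] : conj_class (s j) = conj_class (s i) by rewrite -E -E'.
  exact: connected_eq (conj_simple_connected Eg) (conj_simple_connected Eg').
apply: (@card_set_le _ _ _ _ (fun p J => exists J0 l0 l,
  [/\ vertices (Omega M k) (parabolic M J0),
      p = [set z | clos_refl_trans _ (edge (Omega M k)) (parabolic M J0) z],
      cent_long J0 l0, cent_long J l & conj_class l = conj_class l0]) finZ _ _).2.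
  move=> _ [H HV <-]; have [J0 [cJ0 EH JO]] := HV.
  have [l0 C0] := cent_long_Omega JO.
  have J00 : J0 != finset.set0 by rewrite -card_gt0 cJ0.
  have [K [l [KZ C E]]] := Zrep _ _ J00 C0.
  exists K; last by exists J0, l0, l; split=> //; rewrite -EH.
  have [g Eg] := eq_conj_class E.
  by rewrite /= inE KZ (conj_cent_long_card C C0 Eg) cJ0 /=.
move=> _ _ J _ _ [J1 [l1 [l [V1 -> C1 C E]]]] [J2 [l2 [l' [V2 -> C2 C' E']]]].
have El := long_uniq C.1 C'.1; rewrite El in E.
have /eq_conj_class [g Eg] : conj_class l1 = conj_class l2 by rewrite -E -E'.
have /eq_conj_class [g' Eg'] : conj_class l2 = conj_class l1 by rewrite -E -E'.
have [->//|ne] := pselect (parabolic M J1 = parabolic M J2).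
apply: connected_eq; apply: rt_step; split=> //=; split.
- exact: ne.
- exact: conj_cent_long_iso C1 C2 Eg.
- by move/esym.
- exact: conj_cent_long_iso C2 C1 Eg'.
Qed.

Lemma sum_O_components_le Z : transversal_spec M Z ->
  \sum_(1 <= k < #|I|.+1) O_components M k <= #|Z|.
Proof.
move=> ZT; apply: (@leq_trans (\sum_(1 <= k < #|I|.+1) \sum_(J in Z) (#|J| == k))).
  rewrite big_nat_cond [X in _ <= X]big_nat_cond; apply: leq_sum => k.
  rewrite andbT => /andP [k0 _]; apply: leq_trans (O_components_le ZT k0) _.
  rewrite -sum1_card big_mkcond [X in _ <= X]big_mkcond /=.
  by apply: leq_sum => J _; rewrite inE; case: (J \in Z) => //=; case: eqP.
rewrite exchange_big /= -[X in _ <= X]sum1_card; apply: leq_sum => J _.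
have -> : \sum_(1 <= k < #|I|.+1) (#|J| == k) =
    count_mem #|J| (index_iota 1 #|I|.+1).
  rewrite -sum1_count [RHS]big_mkcond; apply: eq_bigr => k _.
  by rewrite /= eq_sym; case: eqP.
by rewrite count_uniq_mem ?iota_uniq //; case: (_ \in _).
Qed.

Lemma finite_maximal_spherical : finite_set (maximal_spherical M).
Proof.
apply: (@sub_finite_set _ _ ((fun J => parabolic M J) @` setT)).
  by move=> _ [[J ->] _ _]; exists J.
exact/finite_image/finite_finset.
Qed.

Lemma par_subset J K : parabolic M J `<=` parabolic M K -> J \subset K.
Proof.
move=> JK; apply/fintype.subsetP => j jJ; apply: (@par_simple_mem _ M).
by apply: JK; exact: par_simple.
Qed.

Lemma maximal_spherical_above J : finite_set (parabolic M J) ->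
  exists2 H, maximal_spherical M H & parabolic M J `<=` H.
Proof.
move=> finJ; pose P K := `[< finite_set (parabolic M K) >] && (J \subset K).
have PJ : P J by rewrite /P subxx andbT; apply/asboolP.
have [K /andP [/asboolP finK JK] maxK] := arg_maxnP (fun K : {set I} => #|K|) PJ.
exists (parabolic M K); last by move=> x; exact: parS JK.
split=> //; first by exists K.
move=> L finL /par_subset KL; suff -> : L = K by [].
apply/esym/eqP; rewrite eqEcard KL; apply: maxK.
by rewrite /P (fintype.subset_trans JK KL) andbT; apply/asboolP.
Qed.

Lemma cc2_le_maximal_spherical :
  cc2 [set: W] <= \sum_(H <- fset_set (maximal_spherical M)) cc2 H.
Proof.
(* A class of the subgroup lies in one class of [W]; being nonempty, it determines that class. *)
pose r (c c' : set W) := c' `<=` c /\ exists x, c' x.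
apply: (@card_set_bigcup _ _ _ _ _ _ r).
- move=> H; rewrite in_fset_set; last exact: finite_maximal_spherical.
  rewrite inE => [[_ finH _]]; apply: finite_image.
  by apply: sub_finite_set finH => x [].
- move=> c /class_long [J [l [J0 C ->]]].
  have [H Hmax JH] := maximal_spherical_above (long_finite C.1).
  exists H; first by rewrite in_fset_set ?inE //; exact: finite_maximal_spherical.
  exists [set l ^ g | g in H].
    exists l => //; split; first exact: JH C.1.1.
    by split; [exact: cent_long_neq1 C | rewrite expg2; exact: long_sq C.1].
  split; first by move=> _ [g _ <-]; exists g.
  exists l; exists 1; rewrite ?conjg1 //.
  by apply: JH; exact: par1.
- move=> c c' b /class_long [J [l [_ _ ->]]] /class_long [J' [l' [_ _ ->]]].
  move=> [bc [x bx]] [bc' _].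
  by rewrite (conj_class_mem (bc _ bx)) (conj_class_mem (bc' _ bx)).
Qed.

Lemma transversal_finite_bound Z : transversal_spec M Z -> #|Z| <= 2 ^ #|I| - 1.
Proof.
move=> [Z1 _ _]; rewrite -card_nonempty_sets; apply: subset_leq_card.
by apply/fintype.subsetP => J /Z1 [J0 _]; rewrite !inE.
Qed.

Lemma transversal_infinite_sub Z : transversal_spec M Z -> infinite_set [set: W] ->
  Z \subset ~: [set finset.set0; [set: I]]%SET.
Proof.
move=> [Z1 _ _] infW; apply/fintype.subsetP => J /Z1 [J0 [l C]].
rewrite !inE negb_or J0; apply/eqP => JT; apply: infW; rewrite JT in C.
by apply: sub_finite_set (long_finite C.1) => x _; exact: par_setT.
Qed.

Lemma transversal_gt0 Z : transversal_spec M Z -> 0 < #|I| -> 0 < #|Z|.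
Proof.
move=> [_ _ Zrep] /card_gt0P [i _].
have i0 : [set i]%SET != finset.set0 by apply/set0Pn; exists i; rewrite inE.
have [K [l [KZ _ _]]] := Zrep _ _ i0 (cent_long1 M i).
by apply/card_gt0P; exists K.
Qed.

(* Here the diagram restricted to [J] is a matching, so the parabolic is a product of
   groups of order 2 and dihedral groups. *)
Lemma cent_long_matching J :
    (forall i j, i \in J -> j \in J -> i != j -> M i j <> 0 /\ ~~ odd (M i j)) ->
    (forall i j k, i \in J -> j \in J -> k \in J -> i != j -> i != k ->
       M i j <> 2 -> M i k <> 2 -> j = k) ->
  exists l, @cent_long _ M J l.
Proof.
have [n] := ubnP #|J|; elim: n J => // n IH J ltJ ev mat.
have [->|/set0Pn [i iJ]] := eqVneq J finset.set0; first by exists 1; exact: cent_long0.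
have rec (C : {set I}) : C \subset J -> i \in C -> (exists l, @cent_long _ M C l) ->
    (forall j k, j \in C -> k \in J -> k \notin C -> j != k /\ M j k = 2) ->
    exists l, @cent_long _ M J l.
  move=> CJ iC [l Cl] Csep; have sub : J :\: C \subset J := finset.subsetDl _ _.
  have [|j k jD kD||l' Dl] := IH (J :\: C)%SET.
  - rewrite -ltnS; apply: leq_trans ltJ; rewrite ltnS; apply: proper_card.
    by apply/properP; split=> //; exists i => //; rewrite inE iC.
  - by apply: ev; exact: (fintype.subsetP sub).
  - move=> a b c aD bD cD; apply: mat; exact: (fintype.subsetP sub).
  exists (l * l'); have <- : (C :|: (J :\: C) = J)%SET.
    by rewrite -{1}(finset.setIidPr CJ) finset.setID.
  apply: cent_long_prod Cl Dl => j k jC; rewrite inE => /andP [kC kJ].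
  exact: Csep.
have [[j [jJ ij Mij]]|none] := pselect (exists j, [/\ j \in J, i != j & M i j <> 2]).
  have [M0 Mev] := ev i j iJ jJ ij.
  have ji : j != i by rewrite eq_sym.
  apply: (rec [set i; j]%SET).
  - by apply/fintype.subsetP => k; rewrite !inE => /orP [] /eqP ->.
  - by rewrite !inE eqxx.
  - exact: cent_long_dihedral.
  - move=> a k; rewrite !inE negb_or => aij kJ /andP [ki kj].
    have ak : a != k by case/orP: aij => /eqP ->; rewrite eq_sym.
    split=> //; apply: contrapT => Mak; case/orP: aij => /eqP Ea; subst a.
      by have := mat i j k iJ jJ kJ ij ak Mij Mak; move/eqP; rewrite eq_sym (negbTE kj).
    have Mji : M j i <> 2 by rewrite cox_sym.
    by have := mat j i k jJ iJ kJ ji ak Mji Mak; move/eqP; rewrite eq_sym (negbTE ki).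
apply: (rec [set i]%SET).
- by rewrite finset.sub1set.
- by rewrite inE.
- by exists (s i); exact: cent_long1.
- move=> a k; rewrite !inE => /eqP -> kJ ki; rewrite eq_sym; split=> //.
  by apply: contrapT => Mik; apply: none; exists k; rewrite eq_sym.
Qed.

(** For [M i j = 2 q + 1] the braid relation itself reads [(s i * s j) ^+ q * s i = s j * (s i * s
    j) ^+ q]. *)
Lemma odd_label_conj i j : odd (M i j) -> exists g, g * s i = s j * g.
Proof.
move=> odd_m; exists ((s i * s j) ^+ (M i j)./2).
have -> : s j * (s i * s j) ^+ (M i j)./2 = dih M (M i j)./2.*2.+1 i j.
  rewrite /= dih_double; elim: _./2 => [|n IH]; first by rewrite mulg1 mul1g.
  by rewrite expgSr mulgA IH expgSr !mulgA.
have <- : dih M (M i j)./2.*2.+1 j i = (s i * s j) ^+ (M i j)./2 * s i.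
  by rewrite -dih_double.
have -> : (M i j)./2.*2.+1 = M i j by rewrite -[RHS]odd_double_half odd_m.
apply: (mulgI (dih M (M i j) j i)^-1); rewrite mulVg dih_braid.
by rewrite simple_rel //; case: (M i j) odd_m.
Qed.

Lemma extremal_labels Z : transversal_spec M Z -> infinite_set [set: W] ->
    2 < #|I| -> #|Z| = 2 ^ #|I| - 2 ->
  #|I| = 3 /\ forall i j, i != j -> M i j <> 0 /\ ~~ odd (M i j).
Proof.
move=> ZT infW I3 cZ; have [Z1 Zinj _] := ZT.
have I0 : 0 < #|I| by apply: leq_trans I3.
have EZ : Z = ~: [set finset.set0; [set: I]]%SET.
  apply/eqP; rewrite eqEcard transversal_infinite_sub //=.
  by rewrite card_proper_sets // cZ.
have inZ J : 0 < #|J| < #|I| -> J \in Z.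
  move=> /andP [J0 JI]; rewrite EZ !inE negb_or -card_gt0 J0.
  by apply: contraTneq JI => ->; rewrite cardsT ltnn.
have even i j : i != j -> M i j <> 0 /\ ~~ odd (M i j).
  move=> ij; split=> [M0|].
    have /Z1 [_ [l C]] : [set i; j]%SET \in Z by apply: inZ; rewrite cards2 ij.
    by apply: zero_label_infinite ij M0 (long_finite C.1); rewrite !inE eqxx ?orbT.
  apply/negP => odd_m.
  have [g E] := odd_label_conj odd_m.
  have := Zinj [set i]%SET [set j]%SET _ _ g _ _ (cent_long1 M i) (cent_long1 M j) E.
  rewrite !inZ ?cards1 ?(ltn_trans _ I3) // => /(_ isT isT) /setP /(_ i).
  by rewrite !inE eqxx (negbTE ij).
split=> //; apply/eqP; rewrite eqn_leq I3 andbT leqNgt; apply/negP => I4.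
have [|i j k _ _ _ ij ik Mij Mik|l C] := @cent_long_matching [set: I]%SET.
- by move=> i j _ _; exact: even.
- apply/eqP; apply: contrapT => /negP jk.
  have kj : k != j by rewrite eq_sym.
  have ji : j != i by rewrite eq_sym.
  have Mji : M j i <> 2 by rewrite cox_sym.
  have ne3 a b : a != b -> M a b <> 3 by move=> /even [_] /[swap] ->.
  have /Z1 [_ [l C]] : [set j; i; k]%SET \in Z.
    by apply: inZ; rewrite finset.setUC cardsU1 cards2 !inE negb_or kj ji eq_sym ik.
  have mem3 : [/\ j \in [set j; i; k]%SET, i \in [set j; i; k]%SET
                & k \in [set j; i; k]%SET] by rewrite !inE !eqxx !orbT.
  apply: (bad_triple_not_long (a := j) (b := i) (c := k) _ C.1).
  split=> //; split=> //.
  (* Either the three form a path through [i] with even labels above 2, or no two of them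
     commute. *)
  have [Mjk|Mjk] := eqVneq (M j k) 2.
    by right; split=> //; split=> //; exact: ne3.
  by left; split=> //; rewrite cox_sym; exact/eqP.
- apply: infW; apply: sub_finite_set (long_finite C.1) => x _; exact: par_setT.
Qed.

End Bounds.

Section PresentedEndomorphism.
Variables (X : choiceType) (R : set (word X)).
Local Notation G := (presented_group R).

Lemma pres_endo_id (h : G -> G) : (forall x y : G, h (x * y) = h x * h y) ->
  (forall i, h (pres_gen R i) = pres_gen R i) -> forall x, h x = x.
Proof.
move=> hM hgen x; rewrite -(pres_reprK x); elim: (repr x : word X) => [|l w IH].
  by apply: (mulgI (h 1)); rewrite -hM !mulg1.
have -> : pres_class R (l :: w) = pres_class R [:: l] * pres_class R w.
  exact/esym/(pres_mulE R [:: l] w).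
rewrite hM IH; congr (_ * _); case: l => i [] //; last exact: hgen.
have E : pres_class R [:: (i, true)] * pres_gen R i = 1.
  by rewrite [LHS](pres_mulE R [:: (i, true)] [:: (i, false)]);
    apply/pres_classP/(Pres_cancel R (i, true)).
apply: (mulIg (pres_gen R i)); rewrite E -{1}(hgen i) -hM E.
by apply: (mulgI (h 1)); rewrite -hM !mulg1.
Qed.

End PresentedEndomorphism.

(** * Triangle groups and sharp examples *)

Section Triangle.
Variables (I : finType) (M : coxeter_matrix I).
Local Notation s := (simple_refl M).

Lemma triangle_iso : #|I| = 3 ->
    (forall i j, i != j -> M i j <> 0 /\ ~~ odd (M i j)) ->
  exists p q r, [/\ 0 < p, 0 < q, 0 < r &
    isomorphic [set: coxeter_group M] [set: triangle_group (2 * p)%N (2 * q)%N (2 * r)%N]].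
Proof.
move=> I3 even; pose e (k : 'I_3) : I := enum_val (cast_ord (esym I3) k).
pose f (i : I) : 'I_3 := cast_ord I3 (enum_rank i).
have ef i : e (f i) = i by rewrite /e /f cast_ordK enum_rankK.
have fe k : f (e k) = k by rewrite /e /f enum_valK cast_ordKV.
pose o (k : nat) : 'I_3 := inord k.
pose m a b := (M (e (o a)) (e (o b)))./2.
have o_neq a b : a < 3 -> b < 3 -> a != b -> e (o a) != e (o b).
  move=> a3 b3 ab; rewrite (can_eq fe) -val_eqE /= /o !inordK //.
have mE a b : a < 3 -> b < 3 -> a != b -> M (e (o a)) (e (o b)) = (2 * m a b)%N.
  move=> a3 b3 ab; have [_ ev] := even _ _ (o_neq a b a3 b3 ab).
  by rewrite /m mul2n even_halfK.
have m_gt0 a b : a < 3 -> b < 3 -> a != b -> 0 < m a b.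
  move=> a3 b3 ab; have [M0 _] := even _ _ (o_neq a b a3 b3 ab).
  by move: M0; rewrite mE //; case: (m a b).
exists (m 0%N 1%N), (m 0%N 2%N), (m 1%N 2%N); split; try exact: m_gt0.
rewrite /triangle_group; set R := [set` _].
pose t k := pres_gen R k : presented_group R.
have valE (w : word 'I_3) : R w -> word_val (pres_gen R) w = 1 :> presented_group R.
  move=> Rw; have -> : word_val (pres_gen R) w = pres_class R w.
    elim: (w) => [|[k []] u IH] //=.
      rewrite IH; have -> : letter_val (pres_gen R) (k, true) = pres_class R [:: (k, true)].
        exact: (pres_invE R [:: (k, false)]).
      exact: (pres_mulE R [:: (k, true)] u).
    by rewrite IH; exact: (pres_mulE R [:: (k, false)] u).
  exact/pres_classP/Pres_relator.
have t2 k : t k * t k = 1.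
  have Rk : R (word_pow [:: (k, false)] 2).
    have -> : k = inord k by rewrite inord_val.
    by case: k => [[|[|[|]]] //= k3]; rewrite /R /= !inE eqxx ?orbT.
  by have := valE _ Rk; rewrite word_val_pow expg2 /word_val /= mulg1.
(* The triangle presentation has one relator for each pair, the Coxeter presentation one for each
   order of the pair; inversion supplies the other. *)
have tij a b : R (word_pow [:: (o a, false); (o b, false)] (M (e (o a)) (e (o b)))) ->
    (t (o a) * t (o b)) ^+ M (e (o a)) (e (o b)) = 1 /\
    (t (o b) * t (o a)) ^+ M (e (o a)) (e (o b)) = 1.
  move=> /valE; rewrite word_val_pow /word_val /= mulg1 => E; split=> //.
  have tV k : (t k)^-1 = t k by exact: mulg1_eq.
  by rewrite -[t (o b)]tV -[t (o a)]tV -invgM expVgn [X in X^-1]E invg1.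
have ko (k : 'I_3) : exists2 a, a < 3 & k = o a by exists k => //; rewrite /o inord_val.
have Mtriangle k l : M (e k) (e l) <> 0 -> (t k * t l) ^+ M (e k) (e l) = 1.
  have [[a a3 ->] [b b3 ->]] := (ko k, ko l).
  move=> _; have [->|ab] := eqVneq a b; first by rewrite cox_diag expg1.
  have R01 := @tij 0%N 1%N; have R02 := @tij 0%N 2%N; have R12 := @tij 1%N 2%N.
  have {}R01 := R01 ltac:(rewrite mE // /R /= !inE eqxx ?orbT //).
  have {}R02 := R02 ltac:(rewrite mE // /R /= !inE eqxx ?orbT //).
  have {}R12 := R12 ltac:(rewrite mE // /R /= !inE eqxx ?orbT //).
  case: a a3 ab => [|[|[|]]] // _; case: b b3 => [|[|[|]]] // _ _;
    rewrite ?[M (e (o 1%N)) (e (o 0))]cox_sym ?[M (e (o 2)) (e (o 0))]cox_sym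
      ?[M (e (o 2)) (e (o 1%N))]cox_sym;
    by [case: R01 | case: R02 | case: R12].
have phiR w : coxeter_relators M w -> word_val (fun i => t (f i)) w = 1.
  move=> [i [j [Mij ->]]]; rewrite word_val_pow /word_val /= mulg1 /letter_val /=.
  by have := @Mtriangle (f i) (f j); rewrite !ef; apply.
have psiR w : R w -> word_val (fun k => s (e k)) w = 1.
  rewrite /R /= !inE => /or4P [/eqP ->|/eqP ->|/eqP ->|/or3P [] /eqP ->];
    rewrite word_val_pow /word_val /= ?mulg1 /letter_val /= ?expg2 ?simpleK //.
  - by rewrite -(mE 0%N 1%N) // simple_rel //; apply: (even _ _ (o_neq 0%N 1%N _ _ _)).1.
  - by rewrite -(mE 0%N 2%N) // simple_rel //; apply: (even _ _ (o_neq 0%N 2%N _ _ _)).1.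
  - by rewrite -(mE 1%N 2%N) // simple_rel //; apply: (even _ _ (o_neq 1%N 2%N _ _ _)).1.
pose phi : coxeter_group M -> presented_group R :=
  @pres_lift _ (coxeter_relators M) (presented_group R) (fun i => t (f i)).
pose psi : presented_group R -> coxeter_group M :=
  @pres_lift _ R (coxeter_group M) (fun k => s (e k)).
have phiM x y : phi (x * y) = phi x * phi y by exact: pres_liftM.
have psiM x y : psi (x * y) = psi x * psi y by exact: pres_liftM.
have phi_gen i : phi (s i) = t (f i) by exact: pres_lift_gen.
have psi_gen k : psi (t k) = s (e k) by exact: pres_lift_gen.
have phiK : cancel phi psi.
  apply: (@pres_endo_id _ (coxeter_relators M) (psi \o phi)) => [x y|i] /=.
    by rewrite phiM psiM.
  by rewrite [phi _]phi_gen psi_gen ef.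
have psiK : cancel psi phi.
  apply: (@pres_endo_id _ R (phi \o psi)) => [x y|k] /=; first by rewrite psiM phiM.
  by rewrite [psi _]psi_gen phi_gen fe.
exists phi; split; last by move=> x y _ _; exact: phiM.
split=> //; first by move=> x y _ _; exact: can_inj phiK _ _.
by move=> y _; exists (psi y).
Qed.

End Triangle.

(** * Groups attaining the bounds *)

Section Examples.

Lemma const_label_diag n c (i : 'I_n) : (if i == i then 1%N else c) = 1%N.
Proof. by rewrite eqxx. Qed.

Lemma const_label_sym n c (i j : 'I_n) :
  (if i == j then 1%N else c) = (if j == i then 1%N else c).
Proof. by rewrite eq_sym. Qed.

Lemma const_label_off n c (c1 : c != 1%N) (i j : 'I_n) :
  i != j -> (if i == j then 1%N else c) <> 1%N.
Proof. by move=> /negbTE ->; exact/eqP. Qed.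

Definition const_matrix n c (c1 : c != 1%N) : coxeter_matrix 'I_n :=
  CoxeterMatrix (@const_label_diag n c) (@const_label_sym n c) (const_label_off c1).

Lemma const_matrixE n c (c1 : c != 1%N) (i j : 'I_n) :
  i != j -> const_matrix n c1 i j = c.
Proof. by rewrite /const_matrix /= => /negbTE ->. Qed.

(** For [n] at least 2 this is [B_2] times a product of [n - 2] copies of [A_1]; [i + j = 1] singles
    out the pair 0, 1. *)
Definition single_label n (i j : 'I_n) : nat :=
  if i == j then 1%N else if (i + j == 1)%N then 4 else 2.

Lemma single_label_diag n (i : 'I_n) : single_label i i = 1%N.
Proof. by rewrite /single_label eqxx. Qed.

Lemma single_label_sym n (i j : 'I_n) : single_label i j = single_label j i.
Proof. by rewrite /single_label eq_sym addnC. Qed.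

Lemma single_label_off n (i j : 'I_n) : i != j -> single_label i j <> 1%N.
Proof. by rewrite /single_label => /negbTE ->; case: ifP. Qed.

Definition single_matrix n : coxeter_matrix 'I_n :=
  CoxeterMatrix (@single_label_diag n) (@single_label_sym n) (@single_label_off n).

Lemma nonabelian_label (I : finType) (M : coxeter_matrix I) i j :
  i != j -> M i j <> 2 -> nonabelian (coxeter_group M).
Proof.
move=> ij Mij; exists (simple_refl M i), (simple_refl M j) => E.
by apply: Mij; exact: simple_commute.
Qed.

Lemma ord_neq01 n : 1 < n -> exists i j : 'I_n, [/\ i != j, i = 0%N :> nat & j = 1%N :> nat].
Proof. by move=> n1; exists (Ordinal (ltnW n1)), (Ordinal n1). Qed.

Lemma not_cent_long_label3 (I : finType) (M : coxeter_matrix I) i j l :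
  i != j -> M i j = 3 -> ~ @cent_long I M [set i; j]%SET l.
Proof.
move=> ij Mij [L cl]; have ji : j != i by rewrite eq_sym.
pose d := simple_refl M i * simple_refl M j * simple_refl M i.
have d3 a b : dih M 3 a b = simple_refl M b * simple_refl M a * simple_refl M b.
  by rewrite /= mul1g.
have dE : d = simple_refl M j * simple_refl M i * simple_refl M j.
  rewrite /d -!d3; apply: (mulgI (dih M 3 j i)^-1); rewrite mulVg dih_braid.
  by rewrite -Mij simple_rel // Mij.
have Ld : long [set i; j]%SET d.
  split; first by rewrite /d -d3 finset.setUC; exact: dih_par.
  move=> k; rewrite !inE => /orP [] /eqP ->.
    by rewrite /d inv_mul_simple inv_dihedral2 // Mij.
  by rewrite dE inv_mul_simple inv_dihedral2 // cox_sym Mij.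
have := cl i; rewrite !inE eqxx => /(_ isT); rewrite (long_uniq L Ld) /commute /d.
rewrite mulsK !mulgA simpleK mul1g => E.
by have := simple_commute ij E; rewrite Mij.
Qed.

(** Only singletons have a central longest element: two generators give the symmetric group of
    degree 3, three an infinite triangle. Odd labels make all simple reflections conjugate. *)
Lemma cc2_const3 n (c1 : 3 != 1%N) : 0 < n ->
  cc2 [set: coxeter_group (const_matrix n c1)] = 1%N.
Proof.
move=> n0; set M := const_matrix n c1.
have ME i j : i != j -> M i j = 3 by exact: const_matrixE.
have [_ [Z ZT ->]] := classes_finite_transversal M; have [Z1 Zinj _] := ZT.
have single J : J \in Z -> exists i, J = [set i]%SET.
  move=> /Z1 [/set0Pn [i iJ] [l C]]; exists i.
  apply/eqP; rewrite finset.eqEsubset finset.sub1set iJ andbT.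
  apply/fintype.subsetP => j jJ; rewrite inE; apply: contraT; rewrite eq_sym => ij.
  have [[k [kJ ki kj]]|none] := pselect (exists k, [/\ k \in J, k != i & k != j]).
    case: (@bad_triple_not_long _ M J i j k l _ C.1); split=> //.
    have jk : j != k by rewrite eq_sym.
    by split=> //; left; rewrite !ME.
  have EJ : J = [set i; j]%SET.
    apply/setP => k; rewrite !inE; apply/idP/orP => [kJ|[] /eqP -> //].
    have [_|ki] := eqVneq k i; first by left.
    have [_|kj] := eqVneq k j; first by right.
    by case: none; exists k.
  by rewrite EJ in C; case: (not_cent_long_label3 ij (ME i j ij) C).
apply/eqP; rewrite eqn_leq (transversal_gt0 ZT) ?card_ord // andbT.
apply/card_le1_eqP => J K JZ KZ; have [[i EJ] [j EK]] := (single J JZ, single K KZ).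
have [g E] : exists g, g * simple_refl M i = simple_refl M j * g.
  have [->|ij] := eqVneq i j; first by exists 1; rewrite mul1g mulg1.
  by apply: odd_label_conj; rewrite ME.
apply/esym; apply: Zinj JZ KZ _ _ E; first by rewrite EJ; exact: cent_long1.
by rewrite EK; exact: cent_long1.
Qed.

Lemma single_matrix_even n (i j : 'I_n) :
  i != j -> single_matrix n i j <> 0 /\ ~~ odd (single_matrix n i j).
Proof. by rewrite /= /single_label => /negbTE ->; case: ifP. Qed.

Lemma cent_long_single n (J : {set 'I_n}) : exists l, @cent_long _ (single_matrix n) J l.
Proof.
apply: cent_long_matching => [i j _ _|i j k _ _ _]; first exact: single_matrix_even.
rewrite /= /single_label => /negbTE -> /negbTE ->.
case: ifP => // /eqP ij; case: ifP => // /eqP ik _ _.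
by apply: val_inj => /=; apply/eqP; rewrite -(eqn_add2l i) ij ik.
Qed.

Lemma cc2_single n : cc2 [set: coxeter_group (single_matrix n)] = (2 ^ n - 1)%N.
Proof.
apply/eqP; rewrite eqn_leq; apply/andP; split.
  have [_ [Z ZT ->]] := classes_finite_transversal (single_matrix n).
  by have := transversal_finite_bound ZT; rewrite card_ord.
rewrite -{1}(card_ord n) -card_nonempty_sets; apply: cc2_ge.
  by move=> J; rewrite !inE => J0; split=> //; exact: cent_long_single.
by move=> J K l l' g _ _; apply: even_labels_conj => i j /single_matrix_even [].
Qed.

Lemma cc2_even_infinite (I : finType) (M : coxeter_matrix I) :
    0 < #|I| -> infinite_set [set: coxeter_group M] ->
    (forall i j, i != j -> ~~ odd (M i j)) ->
    (forall J : {set I}, #|J| < #|I| -> exists l, @cent_long _ M J l) ->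
  cc2 [set: coxeter_group M] = (2 ^ #|I| - 2)%N.
Proof.
move=> I0 infW ev proper; rewrite -card_proper_sets //.
apply/eqP; rewrite eqn_leq; apply/andP; split.
  have [_ [Z ZT ->]] := classes_finite_transversal M.
  exact/subset_leq_card/(transversal_infinite_sub ZT infW).
apply: cc2_ge => [J|J K l l' g _ _]; last exact: even_labels_conj.
rewrite !inE negb_or => /andP [J0 JT]; split=> //; apply: proper.
rewrite ltn_neqAle max_card andbT; apply: contra JT => /eqP cJ.
by rewrite eqEcard finset.subsetT cardsT cJ /=.
Qed.

End Examples.

Local Close Scope group_scope.

Theorem theorem1p4 :
  (forall (I : finType) (M : coxeter_matrix I),
     let n := #|I| in
     let W := [set: coxeter_group M] in
     1 <= n ->
     [/\ finite_set (involution_classes W),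
         \sum_(1 <= k < n.+1) O_components M k <= cc2 W
           /\ cc2 W <= \sum_(H <- fset_set (maximal_spherical M)) cc2 H,
         [/\ 1 <= cc2 W,
             finite_set W -> cc2 W <= 2 ^ n - 1
           & infinite_set W -> cc2 W <= 2 ^ n - 2]
       & infinite_set W -> 3 <= n -> cc2 W = 2 ^ n - 2 ->
           n = 3 /\
           exists p q r, [/\ 0 < p, 0 < q, 0 < r &
             isomorphic W [set: triangle_group (2 * p) (2 * q) (2 * r)]]])
  /\
  [/\ (forall n, 1 <= n -> exists M : coxeter_matrix 'I_n,
         cc2 [set: coxeter_group M] = 1
         /\ (2 <= n -> nonabelian (coxeter_group M))),
      (forall n, 1 <= n -> exists M : coxeter_matrix 'I_n,
         [/\ finite_set [set: coxeter_group M],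
             cc2 [set: coxeter_group M] = 2 ^ n - 1
           & 2 <= n -> nonabelian (coxeter_group M)])
    & (forall n, n = 2 \/ n = 3 -> exists M : coxeter_matrix 'I_n,
         [/\ infinite_set [set: coxeter_group M],
             cc2 [set: coxeter_group M] = 2 ^ n - 2
           & nonabelian (coxeter_group M)])].
Proof.
split.
  move=> I M n W n1; have [finC [Z ZT EZ]] := classes_finite_transversal M.
  split=> //.
  - by rewrite EZ; split; [exact: sum_O_components_le | rewrite -EZ; exact: cc2_le_maximal_spherical].
  - rewrite EZ; split=> [|_|infW].
    + exact: transversal_gt0 ZT n1.
    + exact: transversal_finite_bound ZT.
    + rewrite /n -(card_proper_sets n1).
      exact: subset_leq_card (transversal_infinite_sub ZT infW).
  - move=> infW n3; rewrite EZ => cZ.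
    have [n3' even] := extremal_labels ZT infW n3 cZ.
    by split=> //; exact: triangle_iso.
split=> [n n1|n n1|n n23].
- have c1 : 3 != 1%N by [].
  exists (const_matrix n c1); split; first exact: cc2_const3.
  move=> /ord_neq01 [i [j [ij _ _]]]; apply: (nonabelian_label ij).
  by rewrite const_matrixE.
- exists (single_matrix n); split; last first.
  + move=> /ord_neq01 [i [j [ij i0 j1]]]; apply: (nonabelian_label ij).
    by rewrite /= /single_label (negbTE ij) i0 j1.
  + exact: cc2_single.
  + have [l C] := @cent_long_single n [set: 'I_n]%SET.
    by apply: sub_finite_set (long_finite C.1) => x _; exact: par_setT.
- case: n23 => ->.
    (* Rank two: the infinite dihedral group, whose proper subsets have at most one element. *)
    have c1 : 0 != 1%N by [].
    have [i [j [ij _ _]]] := @ord_neq01 2 isT.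
    have M0 := const_matrixE c1 ij.
    have inf : infinite_set [set: coxeter_group (const_matrix 2 c1)].
      move=> fin; have := zero_label_infinite (finset.in_setT i) (finset.in_setT j) ij M0.
      by apply; exact: sub_finite_set fin.
    exists (const_matrix 2 c1); split=> //; last by apply: (nonabelian_label ij); rewrite M0.
    have := @cc2_even_infinite _ (const_matrix 2 c1); rewrite card_ord; apply=> //.
      by move=> a b ab; rewrite const_matrixE.
    move=> J; rewrite ltnS => J1; apply: cent_long_matching => [a b aJ bJ ab|a b c aJ bJ _ ab].
      by move/card_le1_eqP: J1 => /(_ a b aJ bJ) E; rewrite E eqxx in ab.
    by move/card_le1_eqP: J1 => /(_ a b aJ bJ) E; rewrite E eqxx in ab.
  (* Rank three: the triangle group with all labels 4. Proper subsets have at most two elements, so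
     they are matchings. *)
  have c1 : 4 != 1%N by [].
  have [i [j [ij i0 j1]]] := @ord_neq01 3 isT.
  pose k : 'I_3 := ord_max.
  have jk : j != k by rewrite -val_eqE /= j1.
  have ki : k != i by rewrite -val_eqE /= i0.
  have inf : infinite_set [set: coxeter_group (const_matrix 3 c1)].
    apply: (@bad_triple_infinite _ _ i j k); split; first by rewrite !inE.
    by split=> //; left; rewrite !const_matrixE.
  exists (const_matrix 3 c1); split=> //; last first.
    by apply: (nonabelian_label ij); rewrite const_matrixE.
  have := @cc2_even_infinite _ (const_matrix 3 c1); rewrite card_ord; apply=> //.
    by move=> a b ab; rewrite const_matrixE.
  move=> J; rewrite ltnS => J2; apply: cent_long_matching => [a b _ _ ab|a b c aJ bJ cJ ab ac _ _].
    by rewrite const_matrixE.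
  apply/eqP; apply: contraTT J2 => bc; rewrite -ltnNge.
  have c3 : #|c |: [set a; b]|%SET = 3.
    by rewrite cardsU1 cards2 !inE negb_or ab !(eq_sym c) ac bc.
  rewrite -[X in X <= _]c3; apply: subset_leq_card; apply/fintype.subsetP => x.
  by rewrite !inE => /or3P [] /eqP ->.
Qed.
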